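(* Let $k$ be an algebraically closed field and let $A$ be a basic finite-dimensional $k$-algebra. Let $\{1_x\}_{x\in \mathcal{O}}$ be a complete set of primitive orthogonal idempotents of $A$ with $\sum_{x \in \mathcal{O}} 1_x = 1$. Let $z \in \mathcal{O}$, put $e = 1_z$ and $\epsilon = 1-e$, and suppose that $\epsilon A e = 0$ (equivalently, all composition factors of the indecomposable projective left module $P_S = Ae$ are isomorphic to its simple top $S$). Suppose that $eAe$ is a self-injective algebra and that there is some $x \in \mathcal{O}$ with $x \neq z$ such that $1_z A 1_x$, as a left $eAe$-module, has a nonzero free direct summand. Then $$T = A\epsilon \oplus \tau^{-1} P_S$$ is a tilting $A$-module, where $\tau$ is the Auslander–Reiten translation of the category of finitely generated left $A$-modules.
   Context: All modules are finitely generated left modules. An $A$-module $T$ is a (classical) tilting module if its projective dimension is at most $1$, $\mathrm{Ext}^1_A(T,T)=0$, and the number of pairwise non-isomorphic indecomposable direct summands of $T$ equals the number of isomorphism classes of simple $A$-modules. In the language of $k$-linear categories, $A$ is viewed as a category $\mathcal{A}$ with object set $\mathcal{O}$ and morphism spaces $\mathcal{A}(x,y) = 1_y A 1_x$; thus $\mathcal{A}(z,z)=eAe$ (a local algebra), $\mathcal{A}(x,z)=1_zA1_x$, and $\mathcal{A}(z,x)=0$ for $x\neq z$. *)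

(* Defs.v *)
From HB Require Import structures.
From mathcomp Require Import all_boot all_algebra all_field.
From mathcomp Require Import boolp functions.

Set Implicit Arguments.
Unset Strict Implicit.
Unset Printing Implicit Defensive.

Import GRing.Theory.
Local Open Scope ring_scope.

(* Left R-modules are [lmodType R]; right R-modules are [lmodType R^c], where
   R^c is the converse ring: for N : lmodType R^c, the element n.r of the
   right module N is written (r : R^c) *: n. *)

Section Modules.
Variable R : pzRingType.
Implicit Types L M N P Q T X Y : lmodType R.

Definition surjective M N (f : {linear M -> N}) := forall y, exists x, f x = y.

Definition mod_iso M N := exists f : {linear M -> N}, bijective f.

Definition exact_at L M N (f : {linear L -> M}) (g : {linear M -> N}) :=
  forall y, g y = 0 <-> exists x, f x = y.

Definition short_exact L M N (f : {linear L -> M}) (g : {linear M -> N}) :=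
  [/\ injective f, exact_at f g & surjective g].

Definition submodule M (U : M -> Prop) :=
  U 0 /\ forall (a : R) u v, U u -> U v -> U (a *: u + v).

Definition fin_gen M := exists n (s : 'I_n -> M),
  forall m, exists c : 'I_n -> R, m = \sum_(i < n) c i *: s i.

Definition projective P :=
  forall M N (g : {linear M -> N}) (f : {linear P -> N}),
    surjective g -> exists h : {linear P -> M}, forall x, g (h x) = f x.

Definition injective_module Q :=
  forall M N (i : {linear M -> N}) (f : {linear M -> Q}),
    injective i -> exists h : {linear N -> Q}, forall x, h (i x) = f x.

Definition direct_summand X T := exists Y, mod_iso T (X * Y)%type.

Definition zero_module M := forall m : M, m = 0.

Definition indecomposable M :=
  ~ zero_module M /\
  forall X Y, mod_iso M (X * Y)%type -> zero_module X \/ zero_module Y.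

Definition simple_module M :=
  ~ zero_module M /\
  forall U : M -> Prop, submodule U ->
    (forall m, U m -> m = 0) \/ (forall m, U m).

Definition has_nonzero_free_summand M :=
  exists n, (0 < n)%N /\ direct_summand 'rV[R]_n M.

Definition pd_le1 M :=
  exists (P1 P0 : lmodType R) (i : {linear P1 -> P0}) (p : {linear P0 -> M}),
    [/\ fin_gen P1 /\ projective P1, fin_gen P0 /\ projective P0
      & short_exact i p].

(* Yoneda Ext: every extension 0 -> N -> E -> M -> 0 is equivalent to the
   split one 0 -> N -> N * M -> M -> 0, whose class is the zero of
   Ext^1(M, N). *)
Definition Ext1_eq0 M N :=
  forall (E : lmodType R) (i : {linear N -> E}) (p : {linear E -> M}),
    short_exact i p ->
    exists h : {linear E -> (N * M)%type},
      [/\ bijective h, forall x, h (i x) = (x, 0) & forall y, (h y).2 = p y].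

(* The modules satisfying the (isomorphism-invariant) property Q form
   exactly n isomorphism classes. *)
Definition num_iso_classes (Q : lmodType R -> Prop) (n : nat) :=
  exists X : 'I_n -> lmodType R,
    [/\ forall i, Q (X i),
        forall i j, mod_iso (X i) (X j) -> i = j
      & forall M, Q M -> exists i, mod_iso M (X i)].

Definition tilting T :=
  [/\ fin_gen T, pd_le1 T, Ext1_eq0 T T
    & exists n,
        num_iso_classes (fun X => indecomposable X /\ direct_summand X T) n /\
        num_iso_classes simple_module n].

(* p is a projective cover of its image, i.e. P is a finitely generated
   projective module and the kernel of p is superfluous in P. *)
Definition proj_cover_of_image P N (p : {linear P -> N}) :=
  [/\ fin_gen P, projective P
    & forall U : P -> Prop, submodule U ->
        (forall x, exists u v, [/\ U u, p v = 0 & x = u + v]) ->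
        forall x, U x].

Definition min_proj_presentation (P1 P0 N : lmodType R)
    (u : {linear P1 -> P0}) (p : {linear P0 -> N}) :=
  [/\ surjective p, exact_at u p,
      proj_cover_of_image p & proj_cover_of_image u].

Definition cokernel L M N (f : {linear L -> M}) (q : {linear M -> N}) :=
  surjective q /\ exact_at f q.

End Modules.

Definition self_injective (R : pzRingType) := injective_module (R^o : lmodType R).

Section Idempotents.
Variable R : pzRingType.

Record idem_elt := IdemElt {
  idem_val : R;
  idem_valM : idem_val * idem_val = idem_val }.

Definition primitive (e : R) :=
  [/\ e * e = e, e != 0
    & forall f g : R, f * f = f -> g * g = g -> f * g = 0 -> g * f = 0 ->
        e = f + g -> f = 0 \/ g = 0].

Definition complete_primitive_orthogonal (O : finType) (ids : O -> R) :=
  [/\ forall x, primitive (ids x),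
      forall x y, x != y -> ids x * ids y = 0
    & \sum_x ids x = 1].

(* The left R-module R e, for e an idempotent; see [mem_lidealP]. *)
Section LeftIdeal.
Variable e : R.

Definition lideal_pred : {pred R^o} := [pred x : R^o | (x : R) * e == x :> R].

Fact lideal_submod_closed : submod_closed lideal_pred.
Proof.
split=> [|a u v]; rewrite !inE ?mul0r // => /eqP hu /eqP hv.
by rewrite mulrDl -[a *: u]/((a : R) * u) -mulrA hu hv.
Qed.
HB.instance Definition _ :=
  GRing.isSubmodClosed.Build R R^o lideal_pred lideal_submod_closed.

Record lideal := Lideal { lideal_val : R^o; _ : lideal_val \in lideal_pred }.
HB.instance Definition _ := [isSub for lideal_val].
HB.instance Definition _ := [Choice of lideal by <:].
HB.instance Definition _ := [SubChoice_isSubLmodule of lideal by <:].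
End LeftIdeal.

Lemma mem_lidealP (e : idem_elt) (x : R) :
  (x : R^o) \in lideal_pred (idem_val e) <->
  exists a, x = a * idem_val e.
Proof.
rewrite inE; split=> [/eqP <-|[a ->]]; first by exists x.
by rewrite -mulrA idem_valM.
Qed.

(* The subgroup e R f, for e and f idempotents; see [mem_peirceP]. *)
Section Peirce.
Variables e f : idem_elt.

Definition peirce_pred : {pred R} :=
  [pred x | idem_val e * x * idem_val f == x].

Fact peirce_zmod_closed : zmod_closed peirce_pred.
Proof.
split=> [|u v]; rewrite !inE ?mulr0 ?mul0r // => /eqP hu /eqP hv.
by rewrite mulrBr mulrBl hu hv.
Qed.
HB.instance Definition _ :=
  GRing.isZmodClosed.Build R peirce_pred peirce_zmod_closed.

Record peirce := Peirce { peirce_val : R; _ : peirce_val \in peirce_pred }.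
HB.instance Definition _ := [isSub for peirce_val].
HB.instance Definition _ := [Choice of peirce by <:].
HB.instance Definition _ := [SubChoice_isSubZmodule of peirce by <:].

Lemma mem_peirceP x :
  x \in peirce_pred <-> exists a, x = idem_val e * a * idem_val f.
Proof.
rewrite inE; split=> [/eqP <-|[a ->]]; first by exists x.
by rewrite !mulrA idem_valM -[_ * idem_val f * idem_val f]mulrA idem_valM.
Qed.
End Peirce.

Lemma peirce_idl e f (x : peirce e f) :
  idem_val e * peirce_val x = peirce_val x.
Proof.
by case: x => x /= /mem_peirceP[a ->]; rewrite !mulrA idem_valM.
Qed.

Lemma peirce_idr e f (x : peirce e f) :
  peirce_val x * idem_val f = peirce_val x.
Proof.
by case: x => x /= /mem_peirceP[a ->]; rewrite -mulrA idem_valM.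
Qed.

Fact peirce_mul_subproof e f g (x : peirce e f) (y : peirce f g) :
  peirce_val x * peirce_val y \in peirce_pred e g.
Proof. by rewrite inE mulrA peirce_idl -mulrA peirce_idr. Qed.

Definition peirce_mul e f g (x : peirce e f) (y : peirce f g) : peirce e g :=
  Peirce (peirce_mul_subproof x y).

Section Corner.
Variable e : idem_elt.

(* The ring e R e, with unit e; the left e R e-module e R f. *)
Definition corner := peirce e e.
HB.instance Definition _ := GRing.Zmodule.on corner.

Fact corner_one_subproof : idem_val e \in peirce_pred e e.
Proof. by rewrite inE !idem_valM. Qed.
Definition corner_one : corner := Peirce corner_one_subproof.

Fact corner_mulA :
  associative (fun x y : corner => peirce_mul x y : corner).
Proof. by move=> x y z; apply/val_inj; rewrite /= mulrA. Qed.
Fact corner_mul1l :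
  left_id corner_one (fun x y : corner => peirce_mul x y : corner).
Proof. by move=> x; apply/val_inj; rewrite /= peirce_idl. Qed.
Fact corner_mul1r :
  right_id corner_one (fun x y : corner => peirce_mul x y : corner).
Proof. by move=> x; apply/val_inj; rewrite /= peirce_idr. Qed.
Fact corner_mulDl :
  left_distributive (fun x y : corner => peirce_mul x y : corner) +%R.
Proof. by move=> x y z; apply/val_inj; rewrite /= mulrDl. Qed.
Fact corner_mulDr :
  right_distributive (fun x y : corner => peirce_mul x y : corner) +%R.
Proof. by move=> x y z; apply/val_inj; rewrite /= mulrDr. Qed.
HB.instance Definition _ := GRing.Zmodule_isPzRing.Build corner
  corner_mulA corner_mul1l corner_mul1r corner_mulDl corner_mulDr.

Variable f : idem_elt.
Let scale (a : corner) (x : peirce e f) : peirce e f := peirce_mul a x.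

Fact peirce_scaleA (a b : corner) x : scale a (scale b x) = scale (a * b) x.
Proof. by apply/val_inj; rewrite /= mulrA. Qed.
Fact peirce_scale1 : left_id 1 scale.
Proof. by move=> x; apply/val_inj; rewrite /= peirce_idl. Qed.
Fact peirce_scaleDr : right_distributive scale +%R.
Proof. by move=> a x y; apply/val_inj; rewrite /= mulrDr. Qed.
Fact peirce_scaleDl x : {morph scale^~ x : a b / a + b}.
Proof. by move=> a b; apply/val_inj; rewrite /= mulrDl. Qed.
HB.instance Definition _ := GRing.Zmodule_isLmodule.Build corner (peirce e f)
  peirce_scaleA peirce_scale1 peirce_scaleDr peirce_scaleDl.
End Corner.
End Idempotents.

(* For a right R-module P, the left R-module Hom(P, R) of right-linear maps,
   with (a.f)(p) = a f(p). *)
Section RingDual.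
Variables (R : pzRingType) (P : lmodType R^c).

Definition star_pred : {pred P -> R} := [pred f : P -> R |
  `[< forall (a : R) u v, f ((a : R^c) *: u + v) = f u * a + f v >]].

Fact star_zmod_closed : zmod_closed star_pred.
Proof.
split=> [|f g /asboolP hf /asboolP hg]; apply/asboolP => a u v /=.
  by rewrite mul0r addr0.
rewrite -[LHS]/(f _ - g _) -[in RHS]/((f u - g u) * a + (f v - g v)).
by rewrite hf hg mulrBl opprD addrACA.
Qed.
HB.instance Definition _ :=
  GRing.isZmodClosed.Build (P -> R) star_pred star_zmod_closed.

Record star := Star { star_val :> P -> R; _ : star_val \in star_pred }.
HB.instance Definition _ := [isSub for star_val].
HB.instance Definition _ := [Choice of star by <:].
HB.instance Definition _ := [SubChoice_isSubZmodule of star by <:].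

Lemma starP (f : star) (a : R) u v :
  f ((a : R^c) *: u + v) = f u * a + f v.
Proof. by case: f => f /= /asboolP. Qed.

Fact star_scale_subproof (a : R) (f : star) :
  (fun p => a * f p) \in star_pred.
Proof. by apply/asboolP => b u v; rewrite starP mulrDr mulrA. Qed.
Definition star_scale a f : star := Star (star_scale_subproof a f).

Fact star_scaleA a b f : star_scale a (star_scale b f) = star_scale (a * b) f.
Proof. by apply/val_inj/funext => p /=; rewrite mulrA. Qed.
Fact star_scale1 : left_id 1 star_scale.
Proof. by move=> f; apply/val_inj/funext => p /=; rewrite mul1r. Qed.
Fact star_scaleDr : right_distributive star_scale +%R.
Proof. by move=> a f g; apply/val_inj/funext => p; apply: mulrDr. Qed.
Fact star_scaleDl f : {morph star_scale^~ f : a b / a + b}.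
Proof. by move=> a b; apply/val_inj/funext => p; apply: mulrDl. Qed.
HB.instance Definition _ := GRing.Zmodule_isLmodule.Build R star
  star_scaleA star_scale1 star_scaleDr star_scaleDl.
End RingDual.

Section RingDualMap.
Variables (R : pzRingType) (P Q : lmodType R^c) (u : {linear P -> Q}).

Fact star_map_subproof (f : star Q) : (fun p => f (u p)) \in @star_pred R P.
Proof. by apply/asboolP => a x y; rewrite linearP starP. Qed.
Definition star_map (f : star Q) : star P := Star (star_map_subproof f).

Fact star_map_linear : linear star_map.
Proof. by move=> a f g; apply/val_inj/funext. Qed.
HB.instance Definition _ :=
  GRing.isLinear.Build R (star Q) (star P) _ star_map star_map_linear.
End RingDualMap.

(* For a left A-module M, the right A-module Hom_k(M, k), with
   (f.a)(m) = f(a m); M is a k-space through the scalars c%:A of A. *)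
Section FieldDual.
Variables (k : fieldType) (A : falgType k) (M : lmodType A).

Definition kdual_pred : {pred M -> k} := [pred f : M -> k |
  `[< forall (c : k) u v, f ((c%:A : A) *: u + v) = c * f u + f v >]].

Fact kdual_zmod_closed : zmod_closed kdual_pred.
Proof.
split=> [|f g /asboolP hf /asboolP hg]; apply/asboolP => a u v /=.
  by rewrite mulr0 addr0.
rewrite -[LHS]/(f _ - g _) -[in RHS]/(a * (f u - g u) + (f v - g v)).
by rewrite hf hg mulrBr opprD addrACA.
Qed.
HB.instance Definition _ :=
  GRing.isZmodClosed.Build (M -> k) kdual_pred kdual_zmod_closed.

Record kdual := KDual { kdual_val :> M -> k; _ : kdual_val \in kdual_pred }.
HB.instance Definition _ := [isSub for kdual_val].
HB.instance Definition _ := [Choice of kdual by <:].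
HB.instance Definition _ := [SubChoice_isSubZmodule of kdual by <:].

Lemma kdualP (f : kdual) (c : k) u v :
  f ((c%:A : A) *: u + v) = c * f u + f v.
Proof. by case: f => f /= /asboolP. Qed.

Fact kdual_scale_subproof (a : A^c) (f : kdual) :
  (fun m => f ((a : A) *: m)) \in kdual_pred.
Proof.
apply/asboolP => c u v; rewrite scalerDr scalerA -kdualP scalerA.
by rewrite -[c%:A * _]scalerAl mul1r -[_ * c%:A]scalerAr mulr1.
Qed.
Definition kdual_scale a f : kdual := KDual (kdual_scale_subproof a f).

Fact kdualD (f : kdual) u v : f (u + v) = f u + f v.
Proof. by rewrite -[u in LHS]scale1r -[1 in LHS]scale1r kdualP mul1r. Qed.

Fact kdual_scaleA (a b : A^c) f :
  kdual_scale a (kdual_scale b f) = kdual_scale (a * b) f.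
Proof. by apply/val_inj/funext => m /=; rewrite scalerA. Qed.
Fact kdual_scale1 : left_id (1 : A^c) kdual_scale.
Proof. by move=> f; apply/val_inj/funext => m /=; rewrite scale1r. Qed.
Fact kdual_scaleDr : right_distributive kdual_scale +%R.
Proof. by move=> a f g; apply/val_inj/funext. Qed.
Fact kdual_scaleDl f :
  {morph kdual_scale^~ f : a b / (a : A^c) + (b : A^c) >-> a + b}.
Proof.
move=> a b; apply/val_inj/funext => m.
rewrite -[RHS]/(f ((a : A) *: m) + f ((b : A) *: m)) -kdualD.
by rewrite -scalerDl.
Qed.
HB.instance Definition _ := GRing.Zmodule_isLmodule.Build A^c kdual
  kdual_scaleA kdual_scale1 kdual_scaleDr kdual_scaleDl.
End FieldDual.

(* C is (isomorphic to) the transpose of the right module N: the cokernel of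
   Hom(P0, A) -> Hom(P1, A) for a minimal projective presentation
   P1 -> P0 -> N -> 0. *)
Definition is_transpose (R : pzRingType) (N : lmodType R^c) (C : lmodType R) :=
  exists (P1 P0 : lmodType R^c) (u : {linear P1 -> P0}) (p : {linear P0 -> N}),
    min_proj_presentation u p /\
    exists q : {linear star P1 -> C}, cokernel (star_map u) q.

(* The inverse Auslander-Reiten translation is Tr D, an operation defined on
   modules up to isomorphism only; hence a relation. *)
Definition is_tau_inv (k : fieldType) (A : falgType k) (M C : lmodType A) :=
  is_transpose (kdual M) C.

(* A is basic: the indecomposable projectives A 1_x given by a complete set of
   primitive orthogonal idempotents are pairwise non-isomorphic. *)
Definition basic_for (R : pzRingType) (O : finType) (ids : O -> R) :=
  forall x y, x != y -> ~ mod_iso (lideal (ids x)) (lideal (ids y)).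

(* Main.v *)
Require Import Defs.
From HB Require Import structures.
From mathcomp Require Import all_boot all_algebra all_field.
From mathcomp Require Import boolp functions.

(** Write L = eAe = Ae. Since L is local and left self-injective it is uniform,
    so it has a simple socle, and a linear form that is nonzero on the socle
    makes D(Ae) = eA / eA(1-e) as a right module. A minimal presentation
    P1 -> eA -> D(Ae) -> 0 dualizes to Ae -> Q -> C -> 0 with Q = Hom(P1, A).
    - Ae -> Q is injective because eA(1-e) is a faithful L-module (this is where
      the free summand enters), so pd C <= 1.
    - P1 is generated by P1(1-e), so Hom(Q, Ae) = 0 and every map from Ae to
      A(1-e) or to Q extends to Q; hence Ext^1(C, A(1-e) + C) = 0.
    - Lifting an idempotent of End C to Q and restricting it to Ae gives 0 or 1,
      and minimality of P1 forces the idempotent itself to be 0 or 1. *)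

Import GRing.Theory.
Local Open Scope ring_scope.

Set Implicit Arguments.
Unset Strict Implicit.
Unset Printing Implicit Defensive.

(** * Submodules, quotients and direct summands *)

(** The condition (1-e)Ae = 0 serves two purposes: it gives Ae = eAe, so that self-injectivity of
    the corner speaks about Ae, and it kills Hom(Q, Ae). The image of P1 -> eA is eA(1-e), and this
    drives the extension properties: a map Ae -> A(1-e) is right multiplication by some y in
    eA(1-e), and if y is the image of w in P1, evaluation at w extends the map to Q. Since the
    inverse translation is a relation, C comes from an arbitrary minimal presentation of D(Ae);
    uniqueness of projective covers is what allows P0 = eA. For the count, C must differ from every
    A1_x. It does, being non-projective: a splitting of Q -> C would give an endomorphism of Q that
    factors through Ae, hence vanishes, and yet fixes the image of Ae. Fitting's lemma, obtained
    from Cayley-Hamilton, supplies locality of endomorphism rings, projective covers and the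
    Krull-Schmidt argument. *)

Section Submodule.
Local Open Scope quotient_scope.
Variables (R : pzRingType) (M : lmodType R) (U : M -> Prop).
Hypothesis sU : submodule U.

Definition submod_pred : {pred M} := fun m => `[< U m >].

Fact submod_pred_closed : submod_closed submod_pred.
Proof.
case: sU => U0 Ulin; split=> [|a u v /asboolP uU /asboolP vU];
  by apply/asboolP; auto.
Qed.
HB.instance Definition _ :=
  GRing.isSubmodClosed.Build R M submod_pred submod_pred_closed.

Record submod := Submod { submod_val : M; _ : submod_val \in submod_pred }.
HB.instance Definition _ := [isSub for submod_val].
HB.instance Definition _ := [Choice of submod by <:].
HB.instance Definition _ := [SubChoice_isSubLmodule of submod by <:].

Definition quotmod := Quotient.quot submod_pred.
HB.instance Definition _ := GRing.Zmodule.on quotmod.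
Let pi (m : M) : quotmod := \pi m.

Let quotmod_scale (a : R) (x : quotmod) : quotmod := pi (a *: repr x).

Let pi_eq (x y : M) : U (x - y) <-> pi x = pi y.
Proof.
have piE : `[< U (x - y) >] = (pi x == pi y).
  exact: (Quotient.idealrBE submod_pred x y).
by split=> [/asboolP|/eqP]; rewrite ?piE -?piE; [rewrite piE => /eqP | move/asboolP].
Qed.

Let pi_scale a m : quotmod_scale a (pi m) = pi (a *: m).
Proof.
apply/pi_eq; rewrite -scalerBr; case: sU => U0 Ulin; rewrite -[_ *: _]addr0.
by apply: Ulin => //; apply/pi_eq; rewrite /pi reprK.
Qed.

Let piD m n : pi m + pi n = pi (m + n).
Proof. by rewrite /pi raddfD. Qed.

Let pi_ind (P : quotmod -> Prop) : (forall m, P (pi m)) -> forall x, P x.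
Proof. by move=> Ppi x; rewrite -[x]reprK; apply: Ppi. Qed.

Fact quotmod_scaleA a b x :
  quotmod_scale a (quotmod_scale b x) = quotmod_scale (a * b) x.
Proof. by elim/pi_ind: x => m; rewrite !pi_scale scalerA. Qed.
Fact quotmod_scale1 : left_id 1 quotmod_scale.
Proof. by elim/pi_ind=> m; rewrite pi_scale scale1r. Qed.
Fact quotmod_scaleDr : right_distributive quotmod_scale +%R.
Proof.
by move=> a; elim/pi_ind=> m; elim/pi_ind=> n; rewrite !(pi_scale, piD) scalerDr.
Qed.
Fact quotmod_scaleDl x : {morph quotmod_scale^~ x : a b / a + b}.
Proof. by elim/pi_ind: x => m a b; rewrite !pi_scale piD scalerDl. Qed.
HB.instance Definition _ := GRing.Zmodule_isLmodule.Build R quotmod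
  quotmod_scaleA quotmod_scale1 quotmod_scaleDr quotmod_scaleDl.

Fact submod_val_linear : linear submod_val.
Proof. by []. Qed.
HB.instance Definition _ :=
  GRing.isLinear.Build R submod M _ submod_val submod_val_linear.

Definition quotmod_proj (m : M) : quotmod := pi m.
Fact quotmod_proj_linear : linear quotmod_proj.
Proof. by move=> a u v; rewrite /quotmod_proj -piD -pi_scale. Qed.
HB.instance Definition _ :=
  GRing.isLinear.Build R M quotmod _ quotmod_proj quotmod_proj_linear.

(** Submodules are predicates; trading them for injective maps with the given image, and for
    quotient maps below, keeps the concrete types out of all later arguments. *)
Lemma submodule_incl : exists (L : lmodType R) (i : {linear L -> M}),
  injective i /\ forall m, U m <-> exists x, i x = m.
Proof.
exists submod, submod_val; split=> [|m]; first exact: val_inj.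
split=> [Um|[[x Ux] <-]]; last exact/asboolP.
have Um' : m \in submod_pred by apply/asboolP.
by exists (Submod Um').
Qed.

Lemma submodule_quotient : exists (Q : lmodType R) (q : {linear M -> Q}),
  surjective q /\ forall m, q m = 0 <-> U m.
Proof.
exists quotmod, quotmod_proj; split=> [|m]; first by elim/pi_ind=> m; exists m.
have -> : (0 : quotmod) = quotmod_proj 0 by rewrite linear0.
by rewrite -[m in U m]subr0; apply: iff_sym; apply: pi_eq.
Qed.

End Submodule.

Section Linear.
Variable R : pzRingType.
Implicit Types K L M N P Q X Y T : lmodType R.

Lemma linear_exists M N (f : M -> N) :
  linear f -> exists g : {linear M -> N}, g =1 f.
Proof.
move=> f_lin; pose mix := GRing.isLinear.Build R M N _ f f_lin.
by exists (HB.pack f mix : {linear M -> N}).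
Qed.

Lemma factor_injective L M N (f : {linear L -> M}) (i : {linear N -> M}) :
  injective i -> (forall x, exists y, i y = f x) ->
  exists g : {linear L -> N}, forall x, i (g x) = f x.
Proof.
move=> i_inj /choice[g igE]; have g_lin : linear g.
  by move=> a u v; apply: i_inj; rewrite linearP !igE linearP.
by have [h hE] := linear_exists g_lin; exists h => x; rewrite hE.
Qed.

Lemma factor_surjective L M N (f : {linear L -> M}) (q : {linear L -> N}) :
  surjective q -> (forall x, q x = 0 -> f x = 0) ->
  exists g : {linear N -> M}, forall x, g (q x) = f x.
Proof.
move=> /choice[s sK] kerq.
have fE x y : q x = q y -> f x = f y.
  move=> qE; apply/eqP; rewrite -subr_eq0 -linearB; apply/eqP/kerq.
  by rewrite linearB qE subrr.
have g_lin : linear (f \o s).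
  by move=> a u v /=; rewrite -linearP; apply: fE; rewrite linearP !sK.
have [h hE] := linear_exists g_lin; exists h => x.
by rewrite hE; apply: fE; rewrite sK.
Qed.

Lemma inj_surj_bij M N (f : {linear M -> N}) :
  injective f -> surjective f -> bijective f.
Proof.
move=> f_inj /choice[g gK]; exists g => // x.
by apply: f_inj; rewrite gK.
Qed.

Lemma bij_surj M N (f : {linear M -> N}) :
  bijective f -> surjective f.
Proof. by case=> g _ gK y; exists (g y). Qed.

Lemma linear0_inj M N (f : {linear M -> N}) :
  (forall x, f x = 0 -> x = 0) -> injective f.
Proof.
move=> f0 x y fE; apply/eqP; rewrite -subr_eq0; apply/eqP/f0.
by rewrite linearB fE subrr.
Qed.

Lemma linear_inv M N (f : {linear M -> N}) : bijective f ->
  exists g : {linear N -> M}, cancel f g /\ cancel g f.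
Proof.
move=> f_bij; have [h fK hK] := f_bij.
have [g gE] := @factor_injective _ _ _ idfun f (bij_inj f_bij) (bij_surj f_bij).
by exists g; split=> // x; apply: (bij_inj f_bij); rewrite gE.
Qed.

Lemma mod_iso_sym M N : mod_iso M N -> mod_iso N M.
Proof. by case=> f /linear_inv[g [fK gK]]; exists g, f. Qed.

Lemma mod_iso_trans M N P : mod_iso M N -> mod_iso N P -> mod_iso M P.
Proof. by case=> f fb [g gb]; exists (g \o f); apply: bij_comp. Qed.

(** The complement is the kernel of [r]; this is recorded through [j] because [indecomposable_idem]
    must know which submodule vanishes. *)
Lemma retract_split X T (i : {linear X -> T}) (r : {linear T -> X}) :
  cancel i r -> exists (Y : lmodType R) (j : {linear Y -> T}),
    (forall t, r t = 0 <-> exists y, j y = t) /\ mod_iso T (X * Y)%type.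
Proof.
move=> iK; have sU : submodule (fun t => r t = 0).
  split=> [|a u v ru rv]; first exact: linear0.
  by rewrite linearP ru rv scaler0 addr0.
have [Y [j [j_inj jP]]] := submodule_incl sU.
have g0 (t : T) : exists y, j y = (idfun \- (i \o r)) t.
  by apply/jP; rewrite /= linearB /= iK subrr.
have [g gE] := factor_injective j_inj g0.
have f_lin : linear (fun t => (r t, g t) : X * Y).
  by move=> a u v; rewrite !linearP.
have [f fE] := linear_exists f_lin.
exists Y, j; split=> //; exists f.
exists (fun xy => i xy.1 + j xy.2) => [t|[x y]] /=.
  by rewrite fE /= gE /= addrC subrK.
have rj : r (j y) = 0 by apply/jP; exists y.
rewrite fE linearD /= iK rj addr0; congr (_, _); apply: j_inj.
by rewrite gE /= linearD iK rj addr0 addrC addKr.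
Qed.

Lemma retract_direct_summand X T (i : {linear X -> T}) (r : {linear T -> X}) :
  cancel i r -> direct_summand X T.
Proof. by move=> /retract_split[Y [_ [_ ?]]]; exists Y. Qed.

Lemma direct_summand_retract X T : direct_summand X T ->
  exists (i : {linear X -> T}) (r : {linear T -> X}), cancel i r.
Proof.
case=> Y [f /linear_inv[g [fK gK]]].
have i_lin : linear (fun x => g (x, 0)).
  move=> a u v; rewrite -linearP; congr (g _).
  by apply: injective_projections => //=; rewrite scaler0 addr0.
have r_lin : linear (fun t => (f t).1) by move=> a u v; rewrite linearP.
have [i iE] := linear_exists i_lin; have [r rE] := linear_exists r_lin.
by exists i, r => x; rewrite rE iE gK.
Qed.

Lemma indecomposable_idem M (e : {linear M -> M}) :
  indecomposable M -> (forall x, e (e x) = e x) ->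
  (forall x, e x = 0) \/ (forall x, e x = x).
Proof.
move=> [_ M_ind] eK.
have sX : submodule (fun x => e x = x).
  by split=> [|a u v eu ev]; rewrite ?linear0 // linearP eu ev.
have [X [i [i_inj iP]]] := submodule_incl sX.
have e_im x : exists y, i y = e x by apply/iP.
have [r rE] := factor_injective i_inj e_im.
have iK : cancel i r.
  by move=> x; apply: i_inj; rewrite rE; apply/iP; exists x.
have [Y [j [jP isoXY]]] := retract_split iK.
have [X0|Y0] := M_ind X Y isoXY; [left|right] => x.
  by rewrite -rE [r x]X0 linear0.
have /jP[y jy] : r (x - e x) = 0.
  by apply: i_inj; rewrite rE linearB eK subrr linear0.
by apply/esym/eqP; rewrite -subr_eq0 -jy [y]Y0 linear0.
Qed.

Lemma idem_indecomposable M : ~ zero_module M ->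
  (forall e : {linear M -> M}, (forall x, e (e x) = e x) ->
     (forall x, e x = 0) \/ (forall x, e x = x)) ->
  indecomposable M.
Proof.
move=> M_neq0 idemM; split=> // X Y [f /linear_inv[g [fK gK]]].
have e_lin : linear (fun x => g ((f x).1, 0)).
  move=> a u v; rewrite -linearP; congr (g _).
  by apply: injective_projections; rewrite linearP //= scaler0 addr0.
have [e eE] := linear_exists e_lin.
have eK x : e (e x) = e x by rewrite !eE gK.
case: (idemM e eK) => e01; [left=> x | right=> y].
  have := e01 (g (x, 0)); rewrite eE gK /= => gx0.
  by have := gK (x, 0); rewrite gx0 linear0 => -[].
by have := e01 (g (0, y)); rewrite eE gK => /(can_inj gK)[].
Qed.

Lemma projective_retract X P (i : {linear X -> P}) (r : {linear P -> X}) :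
  cancel i r -> projective P -> projective X.
Proof.
move=> iK projP M N g f g_surj.
have [h hE] := projP M N g (f \o r) g_surj.
by exists (h \o i) => x /=; rewrite hE /= iK.
Qed.

Lemma projective_prod P Q :
  projective P -> projective Q -> projective (P * Q)%type.
Proof.
move=> projP projQ M N g f g_surj.
have inP : linear (fun x : P => (x, 0 : Q)).
  by move=> a u v; apply: injective_projections => //=; rewrite scaler0 addr0.
have inQ : linear (fun x : Q => (0 : P, x)).
  by move=> a u v; apply: injective_projections => //=; rewrite scaler0 addr0.
have [iP iPE] := linear_exists inP; have [iQ iQE] := linear_exists inQ.
have [hP hPE] := projP M N g (f \o iP) g_surj.
have [hQ hQE] := projQ M N g (f \o iQ) g_surj.
exists ((hP \o fst) \+ (hQ \o snd)) => -[x y] /=.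
rewrite linearD hPE hQE /= -linearD iPE iQE; congr (f _).
by apply: injective_projections; rewrite /= ?addr0 ?add0r.
Qed.

Lemma fin_gen_surj M N (f : {linear M -> N}) :
  surjective f -> fin_gen M -> fin_gen N.
Proof.
move=> f_surj [n [s sP]]; exists n, (f \o s) => y.
have [x <-] := f_surj y; have [c ->] := sP x; exists c.
by rewrite linear_sum; apply: eq_bigr => i _; rewrite linearZ.
Qed.

Lemma fin_gen_prod M N : fin_gen M -> fin_gen N -> fin_gen (M * N)%type.
Proof.
move=> [m [s sP]] [n [t tP]].
exists (m + n)%N, (fun i => match fintype.split i with
  inl i => (s i, 0) | inr i => (0, t i) end) => -[x y].
have [c ->] := sP x; have [d ->] := tP y.
exists (fun i => match fintype.split i with inl i => c i | inr i => d i end).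
rewrite big_split_ord /=.
under [X in _ = X + _]eq_bigr do rewrite (unsplitK (inl _)).
under [X in _ = _ + X]eq_bigr do rewrite (unsplitK (inr _)).
apply: injective_projections; rewrite /= !(raddf_sum fst, raddf_sum snd) /=.
  by rewrite [X in _ + X]big1 ?addr0 // => i _; rewrite scaler0.
by rewrite [X in X + _]big1 ?add0r // => i _; rewrite scaler0.
Qed.
End Linear.

(** * Fitting's lemma and projective covers *)

Section FiniteOverField.
Variables (k : fieldType) (R : pzRingType) (phi : {rmorphism k -> R}).
Hypothesis phi_central : forall c r, phi c * r = r * phi c.
Implicit Types M N P X : lmodType R.

(** This says that M has dimension at most d over k, acting through [phi]. Keeping [phi] abstract
    lets the results apply to A and to its opposite, that is, to left and right modules. *)
Definition kspanned M (d : nat) := exists s : 'I_d -> M,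
  forall m, exists c : 'I_d -> k, m = \sum_i phi (c i) *: s i.

Lemma kspanned_fin (I : finType) M (s : I -> M) :
  (forall m, exists c : I -> k, m = \sum_i phi (c i) *: s i) ->
  kspanned M #|I|.
Proof.
move=> sP; exists (s \o enum_val) => m; have [c ->] := sP m.
exists (c \o enum_val); rewrite (reindex (@enum_val I I)) //=.
by apply: onW_bij; exists enum_rank; [exact: enum_valK|exact: enum_rankK].
Qed.

Lemma kspannedS M d : kspanned M d -> kspanned M d.+1.
Proof.
case=> s sP.
exists (fun i => if unlift ord0 i is Some j then s j else 0) => m.
have [c ->] := sP m.
exists (fun i => if unlift ord0 i is Some j then c j else 0).
rewrite big_ord_recl unlift_none scaler0 add0r.
by apply: eq_bigr => i _; rewrite liftK.
Qed.

Lemma kspanned_fin_gen M : (exists d, kspanned R^o d) -> fin_gen M ->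
  exists d, kspanned M d.
Proof.
move=> [d [b bP]] [n [s sP]].
exists #|{: 'I_n * 'I_d}|.
apply: (@kspanned_fin _ M (fun ij => (b ij.2 : R) *: s ij.1)) => m.
have [r ->] := sP m; have /choice[c cP] j := bP (r j).
exists (fun ij => c ij.1 ij.2).
rewrite -(pair_bigA _ (fun i j => phi (c i j) *: ((b j : R) *: s i))) /=.
apply: eq_bigr => i _; rewrite {1}[r i]cP scaler_suml.
by apply: eq_bigr => j _; rewrite scalerA.
Qed.

Section Coordinates.
Variables (M : lmodType R) (d : nat) (s : 'I_d -> M).
Hypothesis sP : forall m, exists c : 'I_d -> k, m = \sum_i phi (c i) *: s i.

Definition comb (v : 'rV[k]_d) : M := \sum_i phi (v 0 i) *: s i.

Lemma comb_surj m : exists v, comb v = m.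
Proof.
have [c ->] := sP m; exists (\row_i c i).
by apply: eq_bigr => i _; rewrite mxE.
Qed.

Lemma combP a u v : comb (a *: u + v) = phi a *: comb u + comb v.
Proof.
rewrite scaler_sumr -big_split; apply: eq_bigr => i _ /=.
by rewrite !mxE rmorphD rmorphM scalerDl scalerA.
Qed.

Lemma comb0 : comb 0 = 0.
Proof. by apply: big1 => i _; rewrite mxE rmorph0 scale0r. Qed.

Lemma comb_sum (n : nat) (c : 'I_n -> k) (v : 'I_n -> 'rV[k]_d) :
  comb (\sum_i c i *: v i) = \sum_i phi (c i) *: comb (v i).
Proof.
elim/big_ind2: _ => [|x1 x2 y1 y2 <- <-|i _]; first exact: comb0.
  by have := combP 1 x2 y2; rewrite rmorph1 !scale1r.
by rewrite -[_ *: _]addr0 combP comb0 addr0.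
Qed.

(** The vectors [s] need not be independent: [F] is a chosen lift of [f] along [comb], not
    determined by [f]. *)
Lemma comb_endo (f : {linear M -> M}) :
  exists F : 'M[k]_d, forall v, f (comb v) = comb (v *m F).
Proof.
have /choice[c cP] i := sP (f (s i)).
exists (\matrix_(i, j) c i j) => v.
rewrite mulmx_sum_row comb_sum linear_sum; apply: eq_bigr => i _.
rewrite linearZ /= cP; congr (_ *: _).
by apply: eq_bigr => j _; rewrite !mxE.
Qed.

End Coordinates.

Lemma iter_linear M (f : {linear M -> M}) n : linear (iter n f).
Proof. by elim: n => // n IHn a u v; rewrite /= IHn linearP. Qed.

(** By Cayley-Hamilton some nonzero polynomial p annihilates f. If m is the lowest index with p_m
    nonzero, solving p(f) = 0 for f^m gives f^m = f^(m+1) g with g a polynomial in f. *)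
Lemma strongly_pi_regular M d (f : {linear M -> M}) : kspanned M d ->
  exists m (g : {linear M -> M}),
    (forall x, f (g x) = g (f x)) /\
    (forall x, iter m f x = iter m.+1 f (g x)).
Proof.
(* The padding zero vector makes the matrix size positive, so that polynomials can be evaluated at
   [F]. *)
case/kspannedS=> s sP; have [F FP] := comb_endo sP f.
have fF i v : iter i f (comb s v) = comb s (v *m F ^+ i).
  elim: i => [|i IHi]; first by rewrite mulmx1.
  by rewrite iterS IHi FP -mulmxA exprSr.
set p := char_poly F; have p_neq0 : p != 0 by exact/monic_neq0/char_poly_monic.
have pf0 x : \sum_(i < size p) phi p`_i *: iter i f x = 0.
  have [v <-] := comb_surj sP x; rewrite (eq_bigr (fun i : 'I_(size p) =>
    phi p`_i *: comb s (v *m F ^+ i))); last by move=> i _; rewrite fF.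
  rewrite -comb_sum; under eq_bigr do rewrite scalemxAr.
  rewrite -mulmx_sumr -[X in v *m X](_ : horner_mx F p = _).
    by rewrite Cayley_Hamilton mulmx0 comb0.
  rewrite -{1}[p]coefK poly_def rmorph_sum; apply: eq_bigr => i _.
  by rewrite /= horner_mxZ rmorphXn /= horner_mx_X.
have [|m p_m m_min] := @ex_minnP (fun i => p`_i != 0).
  by exists (size p).-1; rewrite -lead_coefE lead_coef_eq0.
have m_lt : (m < size p)%N.
  by rewrite ltnNge; apply: contra p_m => /leq_sizeP->.
pose n := (size p - m.+1)%N.
have g_lin : linear (fun x =>
    \sum_(i < n) phi (- (p`_m)^-1 * p`_(i + m.+1)) *: iter i f x).
  move=> a u v; rewrite scaler_sumr -big_split; apply: eq_bigr => i _ /=.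
  by rewrite iter_linear scalerDr !scalerA phi_central.
have [g gE] := linear_exists g_lin; exists m, g; split=> x.
  rewrite !gE linear_sum; apply: eq_bigr => i _.
  by rewrite linearZ /= -iterSr.
have [h hE] := linear_exists (@iter_linear _ f m.+1).
rewrite -hE gE linear_sum; under eq_bigr do rewrite linearZ /= hE -iterD addnC.
have := pf0 x; rewrite -(big_mkord xpredT (fun i => phi p`_i *: iter i f x)).
rewrite (big_cat_nat (n := m)) ?(ltnW m_lt) //= big_nat_cond big1 ?add0r; last first.
  move=> i /andP[/andP[_ i_lt] _]; suff /eqP-> : p`_i == 0 by rewrite rmorph0 scale0r.
  by apply: contraTT i_lt => /m_min; rewrite -leqNgt.
rewrite big_ltn // -{1}[m.+1]add0n big_addn big_mkord => /eqP.
rewrite addr_eq0 => /eqP /(congr1 (fun y => phi (p`_m)^-1 *: y)).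
rewrite scalerA -rmorphM mulVf // rmorph1 scale1r => ->.
rewrite scalerN -scaleNr -rmorphN scaler_sumr; apply: eq_bigr => i _.
by rewrite scalerA -rmorphM -iterS -addSn addnC.
Qed.

(** With h = g^(m+1), the map f^(m+1) h is the Fitting idempotent: its kernel is that of f^(m+1).
    The exponent m+1 guarantees one factor f to split off in the applications. *)
Lemma fitting M d (f : {linear M -> M}) : kspanned M d ->
  exists m (h : {linear M -> M}),
    [/\ forall x, iter m.+1 f (h x) = h (iter m.+1 f x)
      & forall x, iter m.+1 f (iter m.+1 f (h x)) = iter m.+1 f x].
Proof.
move=> /(strongly_pi_regular f)[m [g [fg fgm]]].
have [h hE] := linear_exists (@iter_linear _ g m.+1).
have fiter n x : iter n f (g x) = g (iter n f x).
  by elim: n => //= n ->.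
exists m, h; split=> x; rewrite !hE.
  by elim: {2 3}m.+1 => // n IHn; rewrite [iter n.+1 g _]iterS fiter IHn.
have {}fgm n : iter m.+1 f x = iter (n + m.+1) f (iter n g x).
  elim: n => // n IHn; rewrite IHn addSnnS [in RHS]iterD iterSr -/(iter n g _).
  by rewrite [in LHS]iterD; congr (iter n f _); rewrite /= fgm iterSr.
by rewrite -iterD -fgm.
Qed.

Lemma iter_id0 M (f : M -> M) n : f 0 = 0 -> iter n f 0 = 0.
Proof. by move=> f0; elim: n => //= n ->. Qed.

Lemma injective_bij M d (f : {linear M -> M}) : kspanned M d ->
  injective f -> bijective f.
Proof.
move=> /(fitting f)[m [h [_ fE]]] f_inj.
have fm_inj : injective (iter m.+1 f).
  by elim: (m.+1) => [x y //|n IHn] x y /f_inj/IHn.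
by apply: inj_surj_bij => // y; exists (iter m f (h y)); apply/fm_inj/fE.
Qed.

Lemma surjective_bij M d (f : {linear M -> M}) : kspanned M d ->
  surjective f -> bijective f.
Proof.
move=> /(fitting f)[m [h [fh fE]]] f_surj.
have fm_surj y n : exists x, iter n f x = y.
  elim: n y => [|n IHn] y; first by exists y.
  by have [x <-] := f_surj y; have [x' <-] := IHn x; exists x'.
apply: inj_surj_bij => //; apply: linear0_inj => x fx0.
have [y yx] := fm_surj x m.+1; rewrite -yx -fE fh fh yx.
by rewrite iterSr fx0 iter_id0 !linear0.
Qed.

Lemma nilpotent_or_bijective M d (f : {linear M -> M}) : kspanned M d ->
  indecomposable M -> bijective f \/ exists m, forall x, iter m f x = 0.
Proof.
move=> Mspan M_ind; have [m [h [fh fE]]] := fitting f Mspan.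
have [fm fmE] := linear_exists (@iter_linear _ f m.+1).
have e_idem x : (fm \o h) ((fm \o h) x) = (fm \o h) x.
  by rewrite /= !fmE fh fE -fh.
have [e0|e1] := indecomposable_idem M_ind e_idem; [right|left].
  exists m.+1 => x; have fh0 : iter m.+1 f (h x) = 0 by rewrite -fmE; apply: e0.
  by rewrite -fE fh0 -fmE linear0.
apply: (injective_bij Mspan); apply: linear0_inj => x fx0.
by rewrite -[x]e1 /= fmE fh iterSr fx0 iter_id0 !linear0.
Qed.

(** If b^-1 f is nilpotent, then b^-1 g is injective: g x = 0 makes x a fixed point of b^-1 f. *)
Lemma local_endo M d (f g b : {linear M -> M}) : kspanned M d ->
  indecomposable M -> bijective b -> (forall x, b x = f x + g x) ->
  bijective f \/ bijective g.
Proof.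
move=> Mspan M_ind b_bij bE; have [b' [bK b'K]] := linear_inv b_bij.
have [|[m nil]] := nilpotent_or_bijective (b' \o f) Mspan M_ind.
  move=> /(bij_comp b_bij) f_bij; left.
  by apply: (eq_bij f_bij) => x; apply: b'K.
right; have g_bij : bijective (b' \o g).
  apply: (injective_bij Mspan); apply: linear0_inj => x /= gx0.
  have fx : b' (f x) = x by rewrite -[RHS]bK bE linearD gx0 addr0.
  by rewrite -(nil x); elim: m {nil} => // n IHn; rewrite iterS /= -IHn.
by apply: (eq_bij (bij_comp b_bij g_bij)) => x; apply: b'K.
Qed.

Lemma local_endo_sum M d (I : eqType) (r : seq I) (f : I -> {linear M -> M})
    (b : {linear M -> M}) : kspanned M d -> indecomposable M ->
  bijective b -> (forall x, b x = \sum_(i <- r) f i x) ->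
  exists2 i, i \in r & bijective (f i).
Proof.
move=> Mspan M_ind; elim: r b => [|i r IHr] b b_bij bE.
  case: M_ind => nz _; case: nz => x; apply: (bij_inj b_bij).
  by rewrite !bE !big_nil.
have s_lin : linear (fun x => \sum_(i <- r) f i x).
  move=> a u v; rewrite scaler_sumr -big_split.
  by apply: eq_bigr => j _; rewrite linearP.
have [s sE] := linear_exists s_lin.
have [x||s_bij] := @local_endo M d (f i) s b Mspan M_ind b_bij.
- by rewrite bE big_cons sE.
- by exists i; rewrite ?mem_head.
have [j jr fj] := IHr s s_bij sE.
by exists j => //; rewrite inE jr orbT.
Qed.

(** X is the image of [e]. A lift of a non-surjective [e] to a matrix cannot have full rank, and a
    basis of its row space spans X. This is the decreasing measure for the construction of
    projective covers. *)
Lemma kspanned_drop M X d (e : {linear M -> M}) (r : {linear M -> X})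
    (i : {linear X -> M}) : kspanned M d -> ~ surjective e ->
  injective i -> surjective r -> (forall x, i (r x) = e x) ->
  exists2 d', (d' < d)%N & kspanned X d'.
Proof.
move=> [s sP] e_nsurj i_inj r_surj irE; have [F FP] := comb_endo sP e.
have rkF : (\rank F < d)%N.
  rewrite ltn_neqAle rank_leq_row andbT; apply/negP => F_full.
  apply: e_nsurj => y; have [v <-] := comb_surj sP y.
  have /submxP[w ->] : (v <= F)%MS by apply: submx_full.
  by exists (comb s w); rewrite FP.
exists (\rank F) => //.
have /choice[t tP] j : exists x, i x = comb s (row j (row_base F)).
  have /submxP[w ->] : (row j (row_base F) <= F)%MS.
    by rewrite (submx_trans (row_sub _ _)) // eq_row_base.
  by exists (r (comb s w)); rewrite irE FP.
exists t => x; have [y <-] := r_surj x; have [v <-] := comb_surj sP y.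
have /submxP[w wE] : (v *m F <= row_base F)%MS.
  by rewrite eq_row_base submxMl.
exists (w 0); apply: i_inj; rewrite irE FP wE mulmx_sum_row comb_sum.
by rewrite linear_sum; apply: eq_bigr => j _; rewrite linearZ /= tP.
Qed.

(** If U is proper and U + ker p = P, lifting p through U gives an endomorphism f with image in U
    and p f = p. Its Fitting idempotent e satisfies p e = p and has image in U, so p restricts to a
    smaller projective, the image of e. *)
Lemma proj_cover_exists P N (p : {linear P -> N}) d :
  kspanned P d -> fin_gen P -> projective P -> surjective p ->
  exists (P' : lmodType R) (p' : {linear P' -> N}),
    surjective p' /\ proj_cover_of_image p'.
Proof.
elim/ltn_ind: d => d IHd in P p *; move=> Pspan Pfg projP p_surj.
have [superfl|/existsNP[U /not_implyP[sU /not_implyP[UK /existsNP[x0 Ux0]]]]] :=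
  pselect (forall U : P -> Prop, submodule U ->
    (forall x, exists u v, [/\ U u, p v = 0 & x = u + v]) -> forall x, U x).
  by exists P, p.
have [L [i [i_inj iP]]] := submodule_incl sU.
have pi_surj : surjective (p \o i).
  move=> y; have [x <-] := p_surj y; have [u [v [/iP[u' <-] pv0 ->]]] := UK x.
  by exists u'; rewrite linearD pv0 addr0.
have [g gE] := projP _ _ (p \o i) p pi_surj.
pose f := i \o g : {linear P -> P}.
have pf n x : p (iter n f x) = p x by elim: n => //= n <-; rewrite -[RHS]gE.
have [m [h [fh fE]]] := fitting f Pspan.
have [fm fmE] := linear_exists (@iter_linear _ f m.+1).
pose e := fm \o h : {linear P -> P}.
have e_idem x : e (e x) = e x by rewrite /= !fmE fh fE -fh.
have e_nsurj : ~ surjective e.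
  move=> /(_ x0)[x /= eE]; apply: Ux0; apply/iP.
  by exists (g (iter m f (h x))); rewrite -eE fmE.
have sX : submodule (fun x => e x = x).
  by split=> [|a u v eu ev]; rewrite ?linear0 // linearP eu ev.
have [X [j [j_inj jP]]] := submodule_incl sX.
have e_im x : exists y, j y = e x by apply/jP.
have [r rE] := factor_injective j_inj e_im.
have jK : cancel j r.
  by move=> x; apply: j_inj; rewrite rE; apply/jP; exists x.
have r_surj : surjective r by move=> x; exists (j x).
have [d' lt_d'd Xspan] := kspanned_drop Pspan e_nsurj j_inj r_surj rE.
apply: (IHd d' lt_d'd X (p \o j)) => //.
- exact: fin_gen_surj r_surj Pfg.
- exact: projective_retract jK projP.
move=> y; have [x <-] := p_surj y; exists (r x).
by rewrite /= rE /= fmE -(pf m.+1) fE pf.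
Qed.

End FiniteOverField.

(** * Projective left ideals and the duality Hom(-, A) *)

Section LeftIdeals.
Variables (R : pzRingType) (e : R).
Hypothesis ee : e * e = e.
Implicit Types M N : lmodType R.
Local Notation Re := (lideal e).

Fact lideal_gen_subproof : (e : R^o) \in lideal_pred e.
Proof. by rewrite inE ee. Qed.
Definition lideal_gen : Re := Lideal lideal_gen_subproof.

Lemma lideal_mulr (x : Re) : lideal_val x * e = lideal_val x.
Proof. by case: x => x /=; rewrite inE => /eqP. Qed.

Lemma lidealE (x : Re) : x = (lideal_val x : R) *: lideal_gen.
Proof. by apply/val_inj; rewrite /= -[RHS]/(_ * _) lideal_mulr. Qed.

Lemma lideal_map M (m : M) :
  exists f : {linear Re -> M}, forall x, f x = (lideal_val x : R) *: m.
Proof.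
have f_lin : linear (fun x : Re => (lideal_val x : R) *: m).
  by move=> a u v; rewrite scalerA -scalerDl.
by have [f fE] := linear_exists f_lin; exists f.
Qed.

Lemma lideal_mapE M (f : {linear Re -> M}) x :
  f x = (lideal_val x : R) *: f lideal_gen.
Proof. by rewrite {1}[x]lidealE linearZ. Qed.

Lemma lideal_fin_gen : fin_gen Re.
Proof.
exists 1%N, (fun=> lideal_gen) => x; exists (fun=> lideal_val x : R).
by rewrite big_ord1 -lidealE.
Qed.

Lemma lideal_projective : projective Re.
Proof.
move=> M N g f g_surj; have [m mE] := g_surj (f lideal_gen).
have [h hE] := lideal_map m; exists h => x.
by rewrite hE linearZ /= mE -lideal_mapE.
Qed.

(** An idempotent endomorphism is right multiplication by an idempotent r of eRe, and e = r + (e -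
    r) is an orthogonal decomposition. *)
Lemma lideal_indecomposable : primitive e -> indecomposable Re.
Proof.
move=> [_ e_neq0 e_prim]; apply: idem_indecomposable.
  by move=> /(_ lideal_gen) /(congr1 val) /eqP; apply/negP.
move=> h hh; set r : R := lideal_val (h lideal_gen).
have hE x : lideal_val (h x) = (lideal_val x : R) * r :> R.
  by rewrite lideal_mapE.
have re : r * e = r by apply: lideal_mulr.
have er : e * r = r := esym (hE lideal_gen).
have rr : r * r = r by rewrite -{1}/r -hE hh.
have [|||||r0|r1] := e_prim r (e - r).
- by [].
- by rewrite mulrBl !mulrBr ee re er rr subrr subr0.
- by rewrite mulrBr re rr subrr.
- by rewrite mulrBl er rr subrr.
- by rewrite addrC subrK.
- by left=> x; apply/val_inj; rewrite /= hE r0 mulr0.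
right=> x; apply/val_inj; rewrite /= hE.
by move/eqP: r1; rewrite subr_eq0 => /eqP <-; rewrite lideal_mulr.
Qed.

End LeftIdeals.

(** * Dual bases of finitely generated projective right modules *)

Section Duality.
Variable R : pzRingType.
Implicit Types (P : lmodType R^c) (M N : lmodType R).

Lemma star_ext P (f g : star P) : f =1 g -> f = g.
Proof. by move=> fg; apply/val_inj/funext. Qed.

Lemma star_addE P (f g : star P) x : (f + g) x = f x + g x.
Proof. by []. Qed.

Lemma star_scaleE P a (f : star P) x : (a *: f) x = a * f x.
Proof. by []. Qed.

Lemma star_sumE P (I : finType) (f : I -> star P) x :
  (\sum_i f i) x = \sum_i f i x.
Proof. by apply: (big_morph (fun g : star P => g x)). Qed.

Lemma star_linearD P (f : star P) x y : f (x + y) = f x + f y.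
Proof. by rewrite -[x in LHS]scale1r starP mulr1. Qed.

Lemma star_linear0 P (f : star P) : f 0 = 0.
Proof. by apply: (addrI (f 0)); rewrite -star_linearD !addr0. Qed.

Lemma star_linearZ P (f : star P) (a : R) x : f ((a : R^c) *: x) = f x * a.
Proof. by rewrite -[_ *: x]addr0 starP star_linear0 addr0. Qed.

Lemma star_of_linear P (f : P -> R) :
    (forall (a : R) u v, f ((a : R^c) *: u + v) = f u * a + f v) ->
  exists g : star P, g =1 f.
Proof.
move=> f_lin; have fP : f \in @star_pred R P by apply/asboolP.
by exists (Star fP).
Qed.

Lemma dual_basis P : fin_gen P -> projective P ->
  exists n (p : 'I_n -> P) (f : 'I_n -> star P),
    forall x, x = \sum_i (f i x : R^c) *: p i.
Proof.
move=> [n [p pP]] projP.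
have c_lin : linear (fun c : 'rV[R^c]_n => \sum_i c 0 i *: p i).
  move=> a u v; rewrite scaler_sumr -big_split; apply: eq_bigr => i _ /=.
  by rewrite !mxE scalerDl scalerA.
have [c cE] := linear_exists c_lin.
have c_surj : surjective c.
  move=> x; have [d ->] := pP x; exists (\row_i d i); rewrite cE.
  by apply: eq_bigr => i _; rewrite mxE.
have [h hE] := projP _ _ c idfun c_surj.
have f_ex (i : 'I_n) : exists f : star P, f =1 fun x => h x 0 i.
  by apply: star_of_linear => a u v; rewrite linearP !mxE.
have [f fE] := choice f_ex; exists n, p, f => x.
by rewrite -{1}[x]hE cE; apply: eq_bigr => i _; rewrite fE.
Qed.

Section DualBasis.
Variables (P : lmodType R^c) (n : nat) (p : 'I_n -> P) (f : 'I_n -> star P).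
Hypothesis pf : forall x, x = \sum_i (f i x : R^c) *: p i.

Lemma dual_basis_star (h : star P) : h = \sum_i h (p i) *: f i.
Proof.
apply: star_ext => x; rewrite star_sumE {1}[x]pf.
rewrite (big_morph h (star_linearD h) (star_linear0 h)).
by apply: eq_bigr => i _; rewrite star_linearZ.
Qed.

Lemma star_map_from M (m : 'I_n -> M) :
  exists g : {linear star P -> M}, forall h, g h = \sum_i h (p i) *: m i.
Proof.
have g_lin : linear (fun h : star P => \sum_i h (p i) *: m i).
  move=> a u v; rewrite scaler_sumr -big_split; apply: eq_bigr => i _.
  by rewrite star_addE star_scaleE scalerDl scalerA.
by have [g gE] := linear_exists g_lin; exists g.
Qed.

Lemma star_fin_gen : fin_gen (star P).
Proof.
exists n, f => h; exists (fun i => h (p i)); exact: dual_basis_star.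
Qed.

Lemma star_projective : projective (star P).
Proof.
move=> M N g phi g_surj; have /choice[m mE] i := g_surj (phi (f i)).
have [h hE] := star_map_from m; exists h => x.
rewrite hE [in RHS](dual_basis_star x) !linear_sum.
by apply: eq_bigr => i _; rewrite !linearZ /= mE.
Qed.

Lemma star_separates (x : P) : (forall h : star P, h x = 0) -> x = 0.
Proof.
by move=> hx0; rewrite [x]pf big1 // => i _; rewrite hx0 scale0r.
Qed.

(* f |-> theta f is induced by an endomorphism of P, since P is reflexive. *)
Lemma star_endo (theta : {linear star P -> star P}) :
  exists t : {linear P -> P}, forall (h : star P) x, h (t x) = theta h x.
Proof.
have t_lin : linear (fun x => \sum_i (theta (f i) x : R^c) *: p i).
  move=> a u v; rewrite scaler_sumr -big_split; apply: eq_bigr => i _ /=.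
  by rewrite starP scalerDl scalerA.
have [t tE] := linear_exists t_lin; exists t => h x.
rewrite tE (big_morph h (star_linearD h) (star_linear0 h)).
rewrite [in RHS](dual_basis_star h) linear_sum star_sumE.
by apply: eq_bigr => i _; rewrite star_linearZ linearZ.
Qed.

End DualBasis.
End Duality.

(** * The cokernel of the dual presentation *)

Section Extensions.
Variable R : pzRingType.
Implicit Types K M N P E : lmodType R.

(** Lift q to a map P -> E. On K it takes values in N; subtracting an extension of this restriction
    to P leaves a map that kills K, so it descends to a section of E -> M. *)
Lemma Ext1_eq0_of_extension K P M N (j : {linear K -> P}) (q : {linear P -> M}) :
  projective P -> exact_at j q -> surjective q ->
  (forall f : {linear K -> N},
     exists g : {linear P -> N}, forall x, g (j x) = f x) ->
  Ext1_eq0 M N.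
Proof.
move=> projP jq q_surj extN E i p [i_inj ip p_surj].
have [phi phiE] := projP _ _ p q p_surj.
have qj x : q (j x) = 0 by apply/jq; exists x.
have pi x : p (i x) = 0 by apply/ip; exists x.
have phij x : exists y, i y = (phi \o j) x by apply/ip; rewrite phiE qj.
have [kap kapE] := factor_injective i_inj phij.
have [kap' kap'E] := extN kap.
have phi'0 x : q x = 0 -> (phi \- (i \o kap')) x = 0.
  by move=> /jq[y <-] /=; rewrite kap'E kapE subrr.
have [s sE] := factor_surjective q_surj phi'0.
have ps y : p (s y) = y.
  by have [x <-] := q_surj y; rewrite sE /= linearB phiE pi subr0.
have r_ex x : exists y, i y = (idfun \- (s \o p)) x.
  by apply/ip; rewrite /= linearB /= ps subrr.
have [r rE] := factor_injective i_inj r_ex.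
have h_lin : linear (fun x => (r x, p x) : N * M).
  by move=> a u v; rewrite !linearP.
have [h hE] := linear_exists h_lin; exists h; split; last by move=> y; rewrite hE.
  exists (fun xy => i xy.1 + s xy.2) => [x|[x y]] /=.
    by rewrite hE /= rE /= subrK.
  have pE : p (i x + s y) = y by rewrite linearD pi add0r ps.
  rewrite hE pE; congr (_, _); apply: i_inj.
  by rewrite rE /= pE addrK.
move=> x; rewrite hE pi; congr (_, _); apply: i_inj.
by rewrite rE /= pi linear0 subr0.
Qed.

Lemma mod_iso_indecomposable M N : mod_iso M N -> indecomposable M ->
  indecomposable N.
Proof.
move=> MN [M_neq0 M_ind]; split=> [N0|X Y NXY].
  apply: M_neq0 => x; have [f f_bij] := MN; apply: (bij_inj f_bij).
  by rewrite !(N0 (f _)).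
by apply: M_ind; apply: mod_iso_trans MN NXY.
Qed.
End Extensions.

Section Transpose.
Variables (R : pzRingType) (e : R).
Hypothesis e_prim : primitive e.
Hypothesis eRe : forall a, (1 - e) * a * e = 0.
Hypothesis eR_faithful : forall b : R, b * e = b ->
  (forall y, e * y = y -> y * e = 0 -> b * y = 0) -> b = 0.

(* The right ideal eR is the left ideal generated by e in R^c. *)
Local Notation eR := (@lideal R^c e).
Local Notation val0 y := (lideal_val y : R).
Variables (N : lmodType R^c) (p : {linear eR -> N}).
Hypothesis p_ker : forall y, p y = 0 <-> val0 y * e = 0.
Variables (P1 : lmodType R^c) (u : {linear P1 -> eR}).
Hypothesis up_exact : exact_at u p.
Hypothesis u_cover : proj_cover_of_image u.
Variables (C : lmodType R) (q : {linear star P1 -> C}).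
Hypothesis q_coker : cokernel (star_map u) q.

Let ee : e * e = e. Proof. by case: e_prim. Qed.
Let cee : (e : R^c) * e = e. Proof. exact: ee. Qed.
Let q_surj : surjective q. Proof. by case: q_coker. Qed.
Let q_exact : exact_at (star_map u) q. Proof. by case: q_coker. Qed.
Let gen : eR := lideal_gen cee.
Let eR_proj : projective eR := lideal_projective cee.

Fact eR_mull (y : eR) : e * val0 y = val0 y.
Proof. exact: (lideal_mulr y). Qed.

Let star_gen_r (x : star eR) : x gen * e = x gen.
Proof.
rewrite -star_linearZ; congr (x _); apply/val_inj; exact: ee.
Qed.

Let star_eR_eval (x : star eR) y : x y = x gen * val0 y.
Proof. by rewrite {1}[y](lidealE cee) star_linearZ. Qed.

Let incl_ex : exists i : star eR, forall y, i y = val0 y.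
Proof.
by have [i iE] := @star_of_linear _ eR (fun y => val0 y)
  (fun a u v => erefl _); exists i.
Qed.

(** Every form on eR is left multiplication by its value at the generator, so the inclusion of eR in
    R generates the dual. *)
Lemma star_eR_iso : mod_iso (lideal e) (star eR).
Proof.
have [i iE] := incl_ex.
have [f fE] := lideal_map e i; exists f; apply: inj_surj_bij.
  apply: linear0_inj => x fx0; apply/val_inj => /=.
  have : f x gen = (lideal_val x : R) * e by rewrite fE star_scaleE iE.
  by rewrite fx0 lideal_mulr.
move=> x; have xe : (x gen : R^o) \in lideal_pred e.
  by rewrite inE star_gen_r.
exists (Lideal xe); rewrite fE /=; apply: star_ext => y.
by rewrite star_scaleE iE -star_eR_eval.
Qed.

Let star_eR_proj : projective (star eR).
Proof.
have [n [s [f sf]]] := dual_basis (lideal_fin_gen cee) eR_proj.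
exact: star_projective sf.
Qed.

Let star_eR_fg : fin_gen (star eR).
Proof.
have [n [s [f sf]]] := dual_basis (lideal_fin_gen cee) eR_proj.
exact: star_fin_gen sf.
Qed.

Let uK w : val0 (u w) * e = 0.
Proof. by apply/p_ker/up_exact; exists w. Qed.

(** A form on eR is left multiplication by some b in Re; if it dies on the image of [u], then b
    annihilates eR(1-e). *)
Lemma star_map_inj : injective (star_map u).
Proof.
apply: linear0_inj => x ux0; apply: star_ext => y; rewrite star_eR_eval.
rewrite (@eR_faithful _ (star_gen_r x)) ?mul0r // => {}y ey ye.
have yR : (y : (R^c)^o) \in lideal_pred (e : R^c) by apply/eqP.
have /up_exact[w uw] : p (Lideal yR) = 0 by apply/p_ker.
rewrite -[x gen * y](star_eR_eval x (Lideal yR)) -uw.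
exact: (congr1 (fun h : star P1 => h w) ux0).
Qed.

Lemma cover_ind (U : P1 -> Prop) : submodule U ->
  (forall w, U ((1 - e : R^c) *: w)) -> forall w, U w.
Proof.
case: u_cover => _ _ superfl sU UE; apply: superfl => // w.
exists ((1 - e : R^c) *: w), ((e : R^c) *: w); split=> //.
  by apply/val_inj; rewrite linearZ; apply: uK.
by rewrite -scalerDl subrK scale1r.
Qed.

(** In a dual basis, f x is a combination of forms with coefficients x(s_i). Every value x(w)
    annihilates the dual of eR: by [cover_ind] one may take w in P1(1-e), so x(w) ends in 1-e, while
    the dual is Re and (1-e)Re = 0. *)
Lemma star_to_eR0 (f : {linear star P1 -> star eR}) x : f x = 0.
Proof.
have [P1_fg P1_proj _] := u_cover.
have [n [s [g sg]]] := dual_basis P1_fg P1_proj.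
rewrite [x](dual_basis_star sg) linear_sum big1 // => i _; rewrite linearZ /=.
have eps (a : R) (y : star eR) : (a * (1 - e)) *: y = 0.
  apply: star_ext => z; rewrite star_scaleE star_eR_eval -star_gen_r.
  have -> : a * (1 - e) * (y gen * e * val0 z) = a * ((1 - e) * y gen * e) * val0 z.
    by rewrite !mulrA.
  by rewrite eRe mulr0 mul0r.
suff: forall w (y : star eR), x w *: y = 0 by apply.
apply: cover_ind => [|w y]; last by rewrite star_linearZ eps.
split=> [y|a v w Uv Uw y]; first by rewrite star_linear0 scale0r.
by rewrite starP scalerDl -scalerA Uv Uw addr0.
Qed.

(** The map f is right multiplication by y = f(i), with i the inclusion of eR in R. Here y lies in
    eR(1-e), so y = u(w), and evaluation at w is the extension. *)
Lemma extend_to_eps (f : {linear star eR -> R^o}) :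
  (forall x, (f x : R) * e = 0) ->
  exists g : {linear star P1 -> R^o}, forall x, g (star_map u x) = f x.
Proof.
move=> fe; have [i iE] := incl_ex.
have ei : i = e *: i by apply: star_ext => y; rewrite star_scaleE !iE eR_mull.
have fi : e * (f i : R) = f i by rewrite [in RHS]ei linearZ.
have yR : (f i : (R^c)^o) \in lideal_pred (e : R^c) by apply/eqP.
have /up_exact[w uw] : p (Lideal yR) = 0 by apply/p_ker/fe.
have ev_lin : linear (fun h : star P1 => h w : R^o) by [].
have [g gE] := linear_exists ev_lin; exists g => x.
rewrite gE /= uw star_eR_eval /=.
have xE : x = x gen *: i.
  by apply: star_ext => y; rewrite star_scaleE iE star_eR_eval.
by rewrite [in RHS]xE linearZ.
Qed.

(** It suffices to extend x |-> f(x)(w) for each w and to reassemble with a dual basis. The w for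
    which this is possible form a submodule, and [extend_to_eps] handles those in P1(1-e). *)
Lemma extend_endo (f : {linear star eR -> star P1}) :
  exists g : {linear star P1 -> star P1}, forall x, g (star_map u x) = f x.
Proof.
have [P1_fg P1_proj _] := u_cover.
have [n [s [b sb]]] := dual_basis P1_fg P1_proj.
have ext w : exists g : {linear star P1 -> R^o},
    forall x, g (star_map u x) = f x w.
  elim/cover_ind: w => [|w].
    split=> [|a v w [g gE] [h hE]].
      by exists (\0 : {linear star P1 -> R^o}) => x; rewrite star_linear0.
    have k_lin : linear (fun x => (g x : R) * a + h x : R^o).
      move=> c x y; have lin (l : {linear star P1 -> R^o}) :
        l (c *: x + y) = c * (l x : R) + l y :> R by rewrite linearP.
      by rewrite !lin mulrDl -mulrA addrACA -mulrDr.
    have [k kE] := linear_exists k_lin; exists k => x.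
    by rewrite kE gE hE starP.
  have k_lin : linear (fun x => f x ((1 - e : R^c) *: w) : R^o).
    by move=> c x y; rewrite linearP.
  have [k kE] := linear_exists k_lin.
  have [x|g gE] := @extend_to_eps k.
    by rewrite kE star_linearZ -mulrA mulrBl ee mul1r subrr mulr0.
  by exists g => x; rewrite gE kE.
have [g gE] := choice (fun i => ext (s i)).
have h_lin : linear (fun x => \sum_i (g i x : R) *: b i).
  move=> a x y; rewrite scaler_sumr -big_split; apply: eq_bigr => i _ /=.
  by rewrite linearP scalerDl scalerA.
have [h hE] := linear_exists h_lin; exists h => x.
rewrite hE [RHS](dual_basis_star sb); apply: eq_bigr => i _.
by rewrite gE.
Qed.

Lemma idem_cover0 (t : {linear star P1 -> star P1}) :
  (forall x, t (t x) = t x) -> (forall x, t (star_map u x) = 0) ->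
  forall x, t x = 0.
Proof.
move=> tt tu x; have [P1_fg P1_proj superfl] := u_cover.
have [n [s [b sb]]] := dual_basis P1_fg P1_proj.
have [n0 [s0 [b0 sb0]]] := dual_basis (lideal_fin_gen cee) eR_proj.
have [d dE] := star_endo sb t.
have dd w : d (d w) = d w.
  apply/eqP; rewrite -subr_eq0; apply/eqP/(star_separates sb) => h.
  rewrite -scaleN1r addrC -[-1]/(-1 : R^c) starP.
  by rewrite !dE tt mulrN1 addNr.
have ud w : u (d w) = 0.
  apply: (star_separates sb0) => h.
  by have := dE (star_map u h) w; rewrite tu.
apply: star_ext => w; rewrite -dE.
suff -> : d w = 0 by rewrite star_linear0.
apply: (superfl (fun w => d w = 0)) => [|{}w].
  split=> [|a v w' dv dw]; first exact: linear0.
  by rewrite linearP dv dw scaler0 addr0.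
exists (w - d w), (d w); split=> //; last by rewrite subrK.
by rewrite linearB dd subrr.
Qed.

Let star_P1_proj : projective (star P1).
Proof.
have [P1_fg P1_proj _] := u_cover.
have [n [s [b sb]]] := dual_basis P1_fg P1_proj.
exact: star_projective sb.
Qed.

Let star_P1_fg : fin_gen (star P1).
Proof.
have [P1_fg P1_proj _] := u_cover.
have [n [s [b sb]]] := dual_basis P1_fg P1_proj.
exact: star_fin_gen sb.
Qed.

Let star_eR_ind : indecomposable (star eR).
Proof. exact: mod_iso_indecomposable star_eR_iso (lideal_indecomposable ee e_prim). Qed.

Let qu x : q (star_map u x) = 0.
Proof. by apply/q_exact; exists x. Qed.

(** Such an f factors through the dual of eR, to which the dual of P1 has no nonzero map. Hence an
    endomorphism of the dual of P1 is determined modulo nothing by its composite with [q]. *)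
Let through_eR0 (f : {linear star P1 -> star P1}) :
  (forall x, q (f x) = 0) -> forall x, f x = 0.
Proof.
move=> qf x; have f_im y : exists z, star_map u z = f y by apply/q_exact.
have [g gE] := factor_injective star_map_inj f_im.
by rewrite -gE star_to_eR0 linear0.
Qed.

Lemma transpose_not_projective : ~ projective C.
Proof.
move=> projC; have [s sE] := projC _ _ q idfun q_surj.
case: star_eR_ind => + _; apply => x; apply: star_map_inj.
have := @through_eR0 (idfun \- (s \o q)) _ (star_map u x).
rewrite linear0 /= qu linear0 subr0; apply => y.
by rewrite /= linearB sE subrr.
Qed.

Lemma transpose_indecomposable : indecomposable C.
Proof.
apply: idem_indecomposable => [C0|g gg].
  apply: transpose_not_projective => M L h f h_surj.
  exists (\0 : {linear C -> M}) => x.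
  by rewrite linear0 [x]C0 linear0.
have [h hE] := @star_P1_proj _ _ q (g \o q) q_surj.
have hu x : exists y, star_map u y = (h \o star_map u) x.
  by apply/q_exact; rewrite hE /= qu linear0.
(* The lift is idempotent on the nose, because hh - h is killed by [q]. *)
have hh x : h (h x) = h x.
  apply/eqP; rewrite -subr_eq0; apply/eqP.
  apply: (through_eR0 (f := (h \o h) \- h)) => y.
  by rewrite /= linearB hE /= hE /= gg subrr.
have [h' h'E] := factor_injective star_map_inj hu.
have h'h' x : h' (h' x) = h' x.
  by apply: star_map_inj; rewrite !h'E /= h'E hh.
have [h'0|h'1] := indecomposable_idem star_eR_ind h'h'; [left|right] => y;
  have [x <-] := q_surj y.
  have := hE x; rewrite /= => <-; rewrite (idem_cover0 hh) ?linear0 // => z.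
  by rewrite -[LHS]h'E h'0 linear0.
have := @idem_cover0 (idfun \- h) _ _ x.
rewrite /= => hx0; rewrite -[LHS]hE -[in RHS](subrK (h x) x) hx0 ?add0r // => z /=.
  by rewrite linearB hh subrr subr0.
by rewrite -[h _]h'E h'1 subrr.
Qed.

Local Notation T := (lideal (1 - e) * C)%type.

Let eps_idem : (1 - e) * (1 - e) = 1 - e.
Proof. by rewrite mulrBr mulr1 mulrBl mul1r ee subrr subr0. Qed.

Lemma transpose_tilting_fin_gen : fin_gen T.
Proof.
apply: fin_gen_prod; first exact: lideal_fin_gen.
exact: fin_gen_surj q_surj star_P1_fg.
Qed.

(** The presentation of C, with the projective A(1-e) added to its middle and right terms, is a
    projective resolution that serves both the dimension bound and the computation of Ext. *)
Let resolution : exists (j : {linear star eR -> (lideal (1 - e) * star P1)%type})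
    (r : {linear (lideal (1 - e) * star P1)%type -> T}),
  short_exact j r /\ forall x, j x = (0, star_map u x).
Proof.
have j_lin : linear (fun x => (0, star_map u x) : lideal (1 - e) * star P1).
  move=> a x y; rewrite linearP.
  by apply: injective_projections => //=; rewrite scaler0 addr0.
have [j jE] := linear_exists j_lin.
have r_lin : linear (fun xy : lideal (1 - e) * star P1 => (xy.1, q xy.2)).
  by move=> a x y; rewrite /= linearP.
have [r rE] := linear_exists r_lin; exists j, r; split=> //; split.
- by move=> x y; rewrite !jE => /(congr1 snd); apply: star_map_inj.
- move=> [x y]; rewrite rE; split=> [[-> /q_exact[z <-]]|[z]].
    by exists z; rewrite jE.
  by rewrite jE => -[<- <-]; rewrite qu.
by move=> [x y]; have [z <-] := q_surj y; exists (x, z); rewrite rE.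
Qed.

Lemma transpose_tilting_pd : pd_le1 T.
Proof.
have [j [r [jr _]]] := resolution.
exists (star eR), (lideal (1 - e) * star P1)%type, j, r; split=> //; split=> //.
  by apply: fin_gen_prod => //; apply: lideal_fin_gen.
by apply: projective_prod => //; apply: lideal_projective.
Qed.

Lemma transpose_tilting_Ext1 : Ext1_eq0 T T.
Proof.
have [j [r [[_ jr r_surj] jE]]] := resolution.
apply: Ext1_eq0_of_extension jr r_surj _.
  by apply: projective_prod => //; apply: lideal_projective.
move=> f.
have f1_lin : linear (fun x => (f x).1) by move=> a x y; rewrite linearP.
have [f1 f1E] := linear_exists f1_lin.
have f2_lin : linear (fun x => (f x).2) by move=> a x y; rewrite linearP.
have [f2 f2E] := linear_exists f2_lin.
have k_lin : linear (fun x => lideal_val (f1 x)).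
  by move=> a x y; rewrite linearP.
have [k kE] := linear_exists k_lin.
have [x|g1 g1E] := extend_to_eps (f := k).
  rewrite kE -[lideal_val (f1 x) : R]lideal_mulr.
  by rewrite -mulrA mulrBl mul1r ee subrr mulr0.
(* The extension [g1] takes values in R; right multiplication by 1-e brings it back into R(1-e)
   without changing it on the dual of eR. *)
have g1'_lin : linear (fun x => (g1 x : R) *: lideal_gen eps_idem).
  by move=> a x y; rewrite linearP scalerDl scalerA.
have [g1' g1'E] := linear_exists g1'_lin.
(* The component in C is lifted to the dual of P1, where [extend_endo] applies. *)
have [l lE] := @star_eR_proj _ _ q f2 q_surj.
have [g2 g2E] := extend_endo l.
have g_lin : linear (fun xy : lideal (1 - e) * star P1 =>
    (g1' xy.2, q (g2 xy.2)) : T).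
  by move=> a x y; rewrite /= !linearP.
have [g gE] := linear_exists g_lin; exists g => x.
rewrite gE jE /= g2E lE f2E g1'E g1E kE f1E.
apply: injective_projections => //=.
by rewrite -lidealE.
Qed.

End Transpose.

(** * Uniqueness of projective covers *)

Section Covers.
Variable R : pzRingType.
Implicit Types N P Q : lmodType R.

Lemma cover_lift_surj P Q N (p : {linear P -> N}) (q : {linear Q -> N})
    (a : {linear P -> Q}) : surjective p -> proj_cover_of_image q ->
  (forall x, q (a x) = p x) -> surjective a.
Proof.
move=> p_surj [_ _ superfl] aE.
apply: (superfl (fun y => exists x, a x = y)) => [|y].
  split=> [|c _ _ [x <-] [x' <-]]; first by exists 0; rewrite linear0.
  by exists (c *: x + x'); rewrite linearP.
have [x xE] := p_surj (q y); exists (a x), (y - a x); split; first by exists x.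
  by rewrite linearB aE xE subrr.
by rewrite addrC subrK.
Qed.

(** A lift [a] of p along q is onto, hence splits. Its section is a lift of q along p, hence onto as
    well, which makes [a] injective. *)
Lemma proj_cover_unique P Q N (p : {linear P -> N}) (q : {linear Q -> N}) :
  surjective p -> surjective q ->
  proj_cover_of_image p -> proj_cover_of_image q ->
  exists a : {linear P -> Q}, bijective a /\ forall x, q (a x) = p x.
Proof.
move=> p_surj q_surj p_cov q_cov.
have [a aE] := let: And3 _ P_proj _ := p_cov in P_proj _ _ q p q_surj.
have a_surj := cover_lift_surj p_surj q_cov aE.
have [s sE] := let: And3 _ Q_proj _ := q_cov in Q_proj _ _ a idfun a_surj.
have s_surj : surjective s.
  by apply: (cover_lift_surj q_surj p_cov) => y; rewrite -aE sE.
exists a; split=> //; apply: inj_surj_bij => //; apply: linear0_inj => x.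
by have [y <-] := s_surj x; rewrite sE => /= ->; rewrite linear0.
Qed.

Lemma row_projective n : projective 'rV[R]_n.
Proof.
move=> M N g f g_surj.
have /choice[m mE] i := g_surj (f (delta_mx 0 i)).
have h_lin : linear (fun v : 'rV[R]_n => \sum_i v 0 i *: m i).
  move=> a u v; rewrite scaler_sumr -big_split; apply: eq_bigr => i _ /=.
  by rewrite !mxE scalerDl scalerA.
have [h hE] := linear_exists h_lin; exists h => v.
rewrite hE [in RHS](row_sum_delta v) !linear_sum; apply: eq_bigr => i _.
by rewrite !linearZ /= mE.
Qed.

Lemma row_fin_gen n : fin_gen 'rV[R]_n.
Proof.
by exists n, (delta_mx 0) => v; exists (v 0); apply: row_sum_delta.
Qed.

End Covers.

Lemma proj_cover_exists_fin_gen (k : fieldType) (R : pzRingType)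
    (phi : {rmorphism k -> R}) (N : lmodType R) :
  (forall c r, phi c * r = r * phi c) -> (exists d, kspanned phi R^o d) ->
  fin_gen N -> exists (P : lmodType R) (p : {linear P -> N}),
    surjective p /\ proj_cover_of_image p.
Proof.
move=> phiC R_fin [n [s sP]].
have f_lin : linear (fun v : 'rV[R]_n => \sum_i v 0 i *: s i).
  move=> a u v; rewrite scaler_sumr -big_split; apply: eq_bigr => i _ /=.
  by rewrite !mxE scalerDl scalerA.
have [f fE] := linear_exists f_lin.
have [d d_span] := kspanned_fin_gen R_fin (@row_fin_gen R n).
apply: (proj_cover_exists phiC d_span (@row_fin_gen R n) (@row_projective R n) (p := f)).
move=> y; have [c ->] := sP y; exists (\row_i c i); rewrite fE.
by apply: eq_bigr => i _; rewrite mxE.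
Qed.

(** A minimal presentation hidden in [is_transpose] is transported along the isomorphism of covers
    P0 -> Q, so that Q can be taken to be eA. *)
Lemma transpose_change_cover (R : pzRingType) (N Q : lmodType R^c)
    (C : lmodType R) (p : {linear Q -> N}) :
  surjective p -> proj_cover_of_image p -> is_transpose N C ->
  exists (P1 : lmodType R^c) (u : {linear P1 -> Q}) (q : {linear star P1 -> C}),
    [/\ exact_at u p, proj_cover_of_image u & cokernel (star_map u) q].
Proof.
move=> p_surj p_cov [P1 [P0 [u [p0 [[p0_surj up0 p0_cov u_cov] [q [q_surj uq]]]]]]].
have [a [a_bij aE]] := proj_cover_unique p0_surj p_surj p0_cov p_cov.
have [b [aK bK]] := linear_inv a_bij.
exists P1, (a \o u), q; split.
- move=> y; rewrite -[y]bK aE; split=> [/up0[x <-]|[x /(can_inj aK) ux]].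
    by exists x.
  by apply/up0; exists x.
- case: u_cov => P1_fg P1_proj superfl; split=> // U sU UK.
  apply: superfl => // x; have [v [w [Uv aw ->]]] := UK x.
  by exists v, w; split=> //; apply: (can_inj aK); rewrite linear0.
split=> // f; split=> [/uq[x <-]|[x <-]].
  by exists (star_map b x); apply: star_ext => y; rewrite /= aK.
by apply/uq; exists (star_map a x); apply: star_ext.
Qed.

(** * The corner algebra as a Frobenius algebra *)

Section FiniteDimensionalAlgebra.
Variables (k : fieldType) (A : falgType k).

Lemma in_alg_central (c : k) (a : A) : in_alg A c * a = a * in_alg A c.
Proof. by rewrite /= -scalerAl mul1r -scalerAr mulr1. Qed.

Lemma falg_kspanned : exists d, kspanned (in_alg A) A^o d.
Proof.
exists (\dim {:A}), (fun i => (vbasis {:A})`_i : A) => m.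
exists (fun i => coord (vbasis {:A}) i m).
rewrite [LHS](coord_vbasis (memvf m)); apply: eq_bigr => i _.
by rewrite -[RHS]/(_ * _) /= mulr_algl.
Qed.

Lemma lideal_kspanned (e : A) : e * e = e ->
  exists d, kspanned (in_alg A) (lideal e) d.
Proof. by move=> /lideal_fin_gen; apply: kspanned_fin_gen falg_kspanned. Qed.

Definition in_algc (c : k) : A^c := c%:A : A.
Fact in_algc_zmod : zmod_morphism in_algc.
Proof. by move=> c d; rewrite /in_algc scalerBl. Qed.
Fact in_algc_monoid : monoid_morphism in_algc.
Proof.
split=> [|c d]; first by rewrite /in_algc scale1r.
by rewrite -[RHS]/((d%:A : A) * (c%:A : A)) mulr_algl scalerA mulrC.
Qed.
HB.instance Definition _ := GRing.isZmodMorphism.Build k A^c in_algc in_algc_zmod.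
HB.instance Definition _ := GRing.isMonoidMorphism.Build k A^c in_algc in_algc_monoid.

Lemma in_algc_central c (a : A^c) : in_algc c * a = a * in_algc c.
Proof. exact/esym/(in_alg_central c a). Qed.

Lemma falgc_kspanned : exists d, kspanned in_algc (A^c)^o d.
Proof.
exists (\dim {:A}), (fun i => (vbasis {:A})`_i : A) => m.
exists (fun i => coord (vbasis {:A}) i (m : A)).
rewrite [LHS](coord_vbasis (memvf (m : A))); apply: eq_bigr => i _.
by rewrite -[RHS]/(((vbasis {:A})`_i : A) * (_ : A)) /in_algc mulr_algr.
Qed.

Section SelfInjectiveCorner.
Variable E : idem_elt A.
Local Notation e := (idem_val E).
Hypothesis e_prim : primitive e.
Hypothesis eAe : forall a, (1 - e) * a * e = 0.
Hypothesis E_selfinj : self_injective (corner E).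

Let ee : e * e = e. Proof. exact: idem_valM. Qed.

(** This identifies Ae with the corner eAe. *)
Lemma eps_annihilates_mull (a : A) : a * e = a -> e * a = a.
Proof.
move=> ae; have := eAe a.
by rewrite mulrBl mul1r mulrBl ae -mulrA ae => /eqP; rewrite subr_eq0 => /eqP.
Qed.

(* If Aa and Ab met trivially, the projection of their sum onto Aa would extend,
   by injectivity, to right multiplication by some r with ar = a and br = 0,
   which is neither nilpotent nor bijective. *)
Lemma corner_uniform (a b : A) : a * e = a -> b * e = b -> a != 0 -> b != 0 ->
  exists x y, x * a = y * b /\ x * a != 0.
Proof.
move=> ae be a0 b0; apply: contrapT => disj.
have ea := eps_annihilates_mull ae; have eb := eps_annihilates_mull be.
have aE : a \in peirce_pred E E by rewrite inE ea ae.
have bE : b \in peirce_pred E E by rewrite inE eb be.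
pose a' : corner E := Peirce aE; pose b' : corner E := Peirce bE.
have sub (m : corner E) :
    submodule (fun v : (corner E)^o => exists x, v = (x * m : corner E)).
  split=> [|c _ _ [x ->] [y ->]]; first by exists 0; rewrite mul0r.
  by exists (c * x + y); rewrite mulrDl -mulrA.
have [La [ia [ia_inj iaP]]] := submodule_incl (sub a').
have [Lb [ib [ib_inj ibP]]] := submodule_incl (sub b').
have i_lin : linear (fun xy : La * Lb => ia xy.1 + ib xy.2).
  by move=> c x y; rewrite /= !linearP scalerDr addrACA.
have [i iE] := linear_exists i_lin.
have i_inj : injective i.
  apply: linear0_inj => -[x y]; rewrite iE /= => xy0.
  have [|c cE] := (iaP (ia x)).2; first by exists x.
  have [|d dE] := (ibP (ib y)).2; first by exists y.
  suff iax0 : ia x = 0.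
    rewrite iax0 add0r in xy0; congr (_, _).
      by apply: ia_inj; rewrite iax0 linear0.
    by apply: ib_inj; rewrite xy0 linear0.
  apply: contrapT => /eqP iax_neq0; apply: disj.
  exists (peirce_val c), (peirce_val (- d)).
  have eq1 : peirce_val c * a = peirce_val (- d) * b.
    apply: (congr1 (@peirce_val A E E)) (_ : c * a' = (- d) * b').
    by move/eqP: xy0; rewrite addr_eq0 cE dE mulNr => /eqP.
  split=> //; apply: contra iax_neq0 => /eqP ca0.
  by apply/eqP; rewrite cE; apply/val_inj.
have [h hE] := E_selfinj (ia \o fst : {linear (La * Lb)%type -> _}) i_inj.
(* An endomorphism of the regular module is right multiplication by its value at 1, which is the r
   announced above. *)
have h_mul (m : corner E) : h m = m * h 1 :> corner E.
  by rewrite -[in RHS]/(m *: h 1) -linearZ /= -[_ *: _]/(_ * _) mulr1.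
pose r : A := peirce_val (h 1).
have ar : a * r = a.
  have [|x xE] := (iaP a').1; first by exists 1; rewrite mul1r.
  have := hE (x, 0); rewrite iE /= linear0 addr0 xE h_mul.
  exact: (congr1 (@peirce_val A E E)).
have br : b * r = 0.
  have [|y yE] := (ibP b').1; first by exists 1; rewrite mul1r.
  have := hE (0, y); rewrite iE /= linear0 add0r yE h_mul.
  exact: (congr1 (@peirce_val A E E)).
have re : r * e = r by apply: peirce_idr.
have rE : (r : A^o) \in lideal_pred e by rewrite inE re.
have [rho rhoE] := lideal_map e (Lideal rE).
have aL : (a : A^o) \in lideal_pred e by rewrite inE ae.
have bL : (b : A^o) \in lideal_pred e by rewrite inE be.
have [d Ae_span] := lideal_kspanned ee.
have [rho_bij|[m nil]] := nilpotent_or_bijective in_alg_central rho Ae_span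
  (lideal_indecomposable ee e_prim).
  have : Lideal bL = 0.
    by apply: (bij_inj rho_bij); rewrite linear0 rhoE; apply/val_inj.
  by move=> /(congr1 val) /= b_eq0; rewrite b_eq0 eqxx in b0.
have rho_a : rho (Lideal aL) = Lideal aL by rewrite rhoE; apply/val_inj.
have : Lideal aL = 0.
  by rewrite -(nil (Lideal aL)); elim: m {nil} => //= m <-; rewrite rho_a.
by move=> /(congr1 val) /= a_eq0; rewrite a_eq0 eqxx in a0.
Qed.

(** Choose s with As of least dimension among nonzero elements of Ae. By uniformity As meets Aa in
    some nonzero xa; minimality gives A(xa) = As, so s lies in Aa. *)
Lemma socle_generator : exists s : A, [/\ s * e = s, s != 0 &
  forall a, a * e = a -> a != 0 -> exists b, b * a = s].
Proof.
pose has_dim n := `[< exists s : A, [/\ s * e = s, s != 0 &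
  \dim (amulr s @: fullv) = n] >].
have ex_dim : exists n, has_dim n.
  exists (\dim (amulr e @: fullv)); apply/asboolP; exists e; split=> //.
  by case: e_prim.
have [n /asboolP[s [se s0 dim_s]] n_min] := ex_minnP ex_dim.
exists s; split=> // a ae a0.
have [x [y [xy xa0]]] := corner_uniform ae se a0 s0.
have sub : (amulr (x * a)%R @: fullv <= amulr s @: fullv)%VS.
  apply/subvP => _ /memv_imgP[c _ ->]; rewrite lfunE /= xy mulrA.
  by apply/memv_imgP; exists (c * y); rewrite ?memvf // lfunE.
have : s \in (amulr (x * a)%R @: fullv)%VS.
  have /eqP -> : (amulr (x * a) @: fullv == amulr s @: fullv)%VS.
    rewrite eqEdim sub dim_s; apply: n_min; apply/asboolP.
    by exists (x * a); rewrite -mulrA ae.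
  by apply/memv_imgP; exists 1; rewrite ?memvf // lfunE /= mul1r.
by case/memv_imgP=> c _ sE; exists (c * x); rewrite sE lfunE /= mulrA.
Qed.

Local Notation eA := (@lideal A^c e).
Local Notation val0 y := (lideal_val y : A).

(** The map sends y to the form m |-> phi(ym), where phi is a linear form with phi(s) nonzero; such
    a phi is a Frobenius form on eAe. *)
Lemma corner_presentation :
  exists p : {linear eA -> kdual (lideal e)},
    surjective p /\ forall y, p y = 0 <-> val0 y * e = 0.
Proof.
have [s [se s0 s_gen]] := socle_generator.
have [i phi_s] : exists i, coord (vbasis {:A}) i s != 0.
  apply: contrapT => s_coord; case/eqP: s0.
  rewrite (coord_vbasis (memvf s)) big1 // => i _.
  suff /eqP-> : coord (vbasis {:A}) i s == 0 by rewrite scale0r.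
  by apply: contrapT => /negP ?; apply: s_coord; exists i.
pose phi : A -> k := coord (vbasis {:A}) i.
have phiP c x y : phi (c *: x + y) = c * phi x + phi y by rewrite /phi linearP.
have p_sub (y : eA) :
    (fun m : lideal e => phi (val0 y * val0 m)) \in kdual_pred (M := lideal e).
  apply/asboolP => c u v; rewrite -phiP; congr phi.
  rewrite /= -[(c%:A : A) *: _]/((c%:A : A) * val0 u) mulrDr; congr (_ + _).
  by rewrite mulr_algl scalerAr.
have p_lin : linear (fun y => KDual (p_sub y)).
  move=> a u v; apply/val_inj/funext => m /=.
  transitivity (1 * phi (val0 u * ((a : A) * val0 m)) + phi (val0 v * val0 m)).
    by rewrite -phiP scale1r mulrA -mulrDl.
  by rewrite mul1r.
have [p pE] := linear_exists p_lin; exists p.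
have p_val y m : p y m = phi (val0 y * val0 m) by rewrite pE.
pose W := (amulr e @: fullv)%VS.
have WP a : reflect (a * e = a) (a \in W).
  apply: (iffP memv_imgP) => [[c _ ->]|<-].
    by rewrite lfunE /= -mulrA ee.
  by exists a; rewrite ?memvf // lfunE.
pose X := vbasis W.
have Xe j : X`_j * e = X`_j.
  have [j_lt|j_ge] := ltnP j (size X); last by rewrite nth_default ?mul0r.
  by apply/WP/vbasis_mem/mem_nth.
have X_lin (v : 'rV[k]_(\dim W)) : (\sum_j v 0 j *: X`_j) * e = \sum_j v 0 j *: X`_j.
  by rewrite mulr_suml; apply: eq_bigr => j _; rewrite -scalerAl Xe.
have X_free (v : 'rV[k]_(\dim W)) : \sum_j v 0 j *: X`_j = 0 -> v = 0.
  move=> v0; apply/rowP => j; rewrite mxE.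
  have Xf : free X by apply: basis_free (vbasisP W).
  by rewrite -(coord_sum_free (v 0) j Xf) v0 linear0.
have phi_sum (I : finType) (c : I -> k) (x : I -> A) :
    phi (\sum_j c j *: x j) = \sum_j c j * phi (x j).
  by rewrite /phi linear_sum; apply: eq_bigr => j _; rewrite linearZ.
pose G := \matrix_(i < \dim W, j < \dim W) phi (X`_i * X`_j).
(* [G] is the Gram matrix of phi(ab) on Ae. If phi(X_j a) = 0 for all j, then a = 0, since otherwise
   some ba equals s. As [G] is square, this gives nondegeneracy in the other argument too. *)
have G_unit : G \in unitmx.
  rewrite -unitmx_tr unitmxE unitfE; apply/negP => /det0P[v v_neq0 vG].
  set a := \sum_j v 0 j *: X`_j; case/eqP: v_neq0; apply: X_free; rewrite -/a.
  apply/eqP; apply: contrapT => /negP a0.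
  have [b bs] := s_gen a (X_lin v) a0; case/eqP: phi_s.
  have bW : b * e \in W by apply/WP; rewrite -mulrA ee.
  have ea : e * a = a by exact: (eps_annihilates_mull (X_lin v)).
  rewrite -/(phi s) -bs -ea mulrA.
  rewrite (coord_vbasis bW) mulr_suml; under eq_bigr do rewrite -scalerAl.
  rewrite phi_sum big1 // => j _; suff -> : phi (X`_j * a) = 0 by rewrite mulr0.
  have /rowP/(_ j) := vG; rewrite !mxE => <-.
  rewrite mulr_sumr; under eq_bigr do rewrite -scalerAr.
  by rewrite phi_sum; apply: eq_bigr => l _; rewrite !mxE.
have phi_G (v : 'rV[k]_(\dim W)) (j : 'I_(\dim W)) :
    phi ((\sum_l v 0 l *: X`_l) * X`_j) = (v *m G) 0 j.
  rewrite mulr_suml; under eq_bigr do rewrite -scalerAl.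
  by rewrite phi_sum mxE; apply: eq_bigr => l _; rewrite !mxE.
have XL (j : 'I_(\dim W)) : (X`_j : A^o) \in lideal_pred e by rewrite inE Xe.
split=> [f|y].
  (* Solving v G = (f(X_j)) yields the element that represents f. *)
  pose v := (\row_j f (Lideal (XL j))) *m invmx G.
  have aL : (\sum_l v 0 l *: X`_l : (A^c)^o) \in lideal_pred (e : A^c).
    by apply/eqP/(eps_annihilates_mull (X_lin v)).
  exists (Lideal aL); apply/eqP; rewrite -subr_eq0; set g := _ - f.
  have gX (j : 'I_(\dim W)) : g (Lideal (XL j)) = 0.
    rewrite -[LHS]/(p (Lideal aL) _ - f _) p_val /= phi_G /v mulmxKV //.
    by rewrite mxE subrr.
  have g0 : g 0 = 0 by apply: (addrI (g 0)); rewrite -kdualD !addr0.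
  apply/eqP/val_inj/funext => m; rewrite -[LHS]/(g m).
  have -> : m = \sum_j ((coord X j (val0 m))%:A : A) *: Lideal (XL j).
    apply/val_inj; rewrite raddf_sum /= {1}(coord_vbasis (_ : val0 m \in W)).
      by apply: eq_bigr => j _; rewrite -[RHS]/(_ * _) mulr_algl.
    by apply/WP/lideal_mulr.
  rewrite (big_morph g (kdualD g) g0) big1 // => j _.
  by rewrite -[_ *: _]addr0 kdualP gX g0 mulr0 addr0.
(* Since m = em for m in Ae, the pairing sees only ye, which lies in Ae where the form is
   nondegenerate. *)
split=> [py0|ye].
  have yeW : val0 y * e \in W by apply/WP; rewrite -mulrA ee.
  have yeE := coord_vbasis yeW.
  set v := \row_j coord X j (val0 y * e).
  suff v0 : v = 0.
    rewrite yeE big1 // => j _; have /rowP/(_ j) := v0.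
    by rewrite !mxE => ->; rewrite scale0r.
  suff : v *m G = 0 by move=> /(congr1 (mulmx^~ (invmx G))); rewrite mulmxK // mul0mx.
  apply/rowP => j; rewrite -phi_G mxE.
  under eq_bigr do rewrite mxE.
  rewrite -yeE -mulrA eps_annihilates_mull //.
  by have := p_val y (Lideal (XL j)); rewrite py0.
apply/val_inj/funext => m; rewrite [LHS]p_val.
rewrite -(eps_annihilates_mull (lideal_mulr m)) mulrA ye mul0r.
by rewrite /phi linear0.
Qed.

End SelfInjectiveCorner.
End FiniteDimensionalAlgebra.

(** * The Krull-Schmidt property and simple modules *)

Section KrullSchmidt.
Variable R : pzRingType.
Implicit Types M N P T Y : lmodType R.

(** The map a (ba)^-1 b is an idempotent of Y; it is not 0 because M is not, so it is the identity
    and [a] is onto. *)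
Lemma bijective_factor M Y (a : {linear M -> Y}) (b : {linear Y -> M}) :
  indecomposable M -> indecomposable Y -> bijective (b \o a) -> mod_iso M Y.
Proof.
move=> [M_neq0 _] Y_ind ba_bij; have [c [baK cK]] := linear_inv ba_bij.
have e_idem y : (a \o (c \o b)) ((a \o (c \o b)) y) = (a \o (c \o b)) y.
  by rewrite /=; congr (a (c _)); apply: cK.
exists a; apply: inj_surj_bij.
  by move=> x y axy; apply: (bij_inj ba_bij); rewrite /= axy.
have [e0|e1] := indecomposable_idem Y_ind e_idem; last first.
  by move=> y; exists (c (b y)); apply: e1.
case: M_neq0 => x; apply: (bij_inj ba_bij).
by rewrite -[x]baK /= -[a (c _)]/((a \o (c \o b)) (a x)) e0 !linear0.
Qed.

(** The identity of M is the sum of the maps r c_i i; locality makes one of them bijective, and it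
    factors through Y_i. *)
Lemma krull_schmidt (k : fieldType) (phi : {rmorphism k -> R}) (I : finType)
    T M d (c : I -> {linear T -> T}) (Y : I -> lmodType R) :
  (forall a r, phi a * r = r * phi a) -> kspanned phi M d ->
  (forall t, \sum_i c i t = t) ->
  (forall i, exists (j : {linear Y i -> T}) (p : {linear T -> Y i}),
     forall t, c i t = j (p t)) ->
  (forall i, indecomposable (Y i)) ->
  indecomposable M -> direct_summand M T -> exists i, mod_iso M (Y i).
Proof.
move=> phiC M_span c_sum c_fac Y_ind M_ind /direct_summand_retract[i [r iK]].
have id_bij : bijective (idfun : {linear M -> M}) by exists idfun.
have [x|x _ rci_bij] := local_endo_sum phiC (r := index_enum I)
    (f := fun x => (r \o (c x \o i)) : {linear M -> M}) M_span M_ind id_bij.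
  by rewrite /= -linear_sum c_sum iK.
have [j [p cE]] := c_fac x; exists x.
apply: (@bijective_factor _ _ (p \o i) (r \o j) M_ind (Y_ind x)).
by apply: (eq_bij rci_bij) => y; rewrite /= cE.
Qed.

End KrullSchmidt.

(** * Simple modules as tops of the projectives A1_x *)

Section Simples.
Variables (k : fieldType) (A : falgType k).

Section Top.
Variable e : A.
Hypothesis e_prim : primitive e.

Let ee : e * e = e. Proof. by case: e_prim. Qed.
Local Notation Ae := (lideal e).
Local Notation gen := (lideal_gen ee).

(* The largest proper submodule of Ae: the elements that do not generate Ae. *)
Definition lideal_rad (u : Ae) := ~ exists a : A, a *: u = gen.

(** If b(au + v) is the generator, right multiplications by bau and bv add up to the identity of Ae;
    one of them is bijective, so u or v generates. *)
Lemma lideal_rad_submodule : submodule lideal_rad.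
Proof.
split=> [[a]|a u v Uu Uv [b]].
  rewrite scaler0 => /(congr1 val) /= e0.
  by case: e_prim => _; rewrite -e0 eqxx.
rewrite scalerDr scalerA => buv.
have [f fE] := lideal_map e ((b * a) *: u).
have [g gE] := lideal_map e (b *: v).
have [d Ae_span] := lideal_kspanned ee.
have Ae_ind := lideal_indecomposable ee e_prim.
have id_bij : bijective (idfun : {linear Ae -> Ae}) by exists idfun.
have [x|/bij_surj/(_ gen)[x]|/bij_surj/(_ gen)[x]] :=
  local_endo (@in_alg_central k A) (f := f) (g := g) Ae_span Ae_ind id_bij.
- by rewrite /= fE gE -scalerDr buv -lidealE.
- by rewrite fE scalerA => xu; apply: Uu; eexists; exact: xu.
by rewrite gE scalerA => xv; apply: Uv; eexists; exact: xv.
Qed.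

Lemma proper_sub_rad (U : Ae -> Prop) : submodule U ->
  (forall x, U x) \/ (forall x, U x -> lideal_rad x).
Proof.
move=> [U0 Ulin]; have scaleU a x : U x -> U (a *: x).
  by move=> Ux; rewrite -[_ *: _]addr0; apply: Ulin.
have [Ugen|nUgen] := pselect (U gen).
  by left=> x; rewrite [x](lidealE ee); apply: scaleU.
by right=> x Ux [a ax]; apply: nUgen; rewrite -ax; apply: scaleU.
Qed.

Lemma gen_notin_rad : ~ lideal_rad gen.
Proof. by apply; exists 1; rewrite scale1r. Qed.

End Top.

Variables (O : finType) (ids : O -> A).
Hypothesis ids_complete : complete_primitive_orthogonal ids.
Hypothesis ids_basic : basic_for ids.

Let ids_prim x : primitive (ids x). Proof. by case: ids_complete. Qed.
Let idsM x : ids x * ids x = ids x. Proof. by case: (ids_prim x). Qed.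

Lemma top_simple (x : O) (S : lmodType A) (q : {linear lideal (ids x) -> S}) :
  surjective q -> (forall u, q u = 0 <-> lideal_rad (ids_prim x) u) ->
  simple_module S.
Proof.
move=> q_surj q_ker; split=> [S0|W [W0 Wlin]].
  by apply: (@gen_notin_rad _ (ids_prim x)); apply/q_ker/S0.
have sqW : submodule (fun u => W (q u)).
  by split=> [|a u v Wu Wv]; rewrite ?linear0 // linearP; apply: Wlin.
have [all|rad] := proper_sub_rad (ids_prim x) sqW; [right|left] => m.
  by have [u <-] := q_surj m; apply: all.
by have [u <-] := q_surj m => Wu; apply/q_ker/rad.
Qed.

(** A nonzero f is onto with kernel inside the radical, so q factors through f; the resulting M -> S
    is onto and its kernel is not all of M. *)
Lemma simple_cover (x : O) (S M : lmodType A)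
    (q : {linear lideal (ids x) -> S}) (f : {linear lideal (ids x) -> M}) :
  surjective q -> (forall u, q u = 0 <-> lideal_rad (ids_prim x) u) ->
  simple_module M -> (exists u, f u <> 0) -> mod_iso M S.
Proof.
move=> q_surj q_ker [M0 M_simple] [u0 fu0].
have sIm : submodule (fun m => exists u, f u = m).
  split=> [|a _ _ [u <-] [v <-]]; first by exists 0; rewrite linear0.
  by exists (a *: u + v); rewrite linearP.
have f_surj : surjective f.
  have [im0|//] := M_simple _ sIm.
  by case: fu0; apply: im0; exists u0.
have sKer : submodule (fun u => f u = 0).
  by split=> [|a u v fu fv]; rewrite ?linear0 // linearP fu fv scaler0 addr0.
have [ker_all|ker_rad] := proper_sub_rad (ids_prim x) sKer.
  by case: fu0; apply: ker_all.
have q_f u : f u = 0 -> q u = 0 by move=> /ker_rad/q_ker.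
have [t tE] := factor_surjective f_surj q_f.
exists t; apply: inj_surj_bij; last first.
  by move=> s; have [u <-] := q_surj s; exists (f u); rewrite tE.
have sKt : submodule (fun m => t m = 0).
  by split=> [|a u v tu tv]; rewrite ?linear0 // linearP tu tv scaler0 addr0.
have [t0|t_all] := M_simple _ sKt; first exact: linear0_inj.
case: (@gen_notin_rad _ (ids_prim x)); apply/q_ker.
by rewrite -tE t_all.
Qed.

(** If the image of the lift lay in the radical, its composite with q' would vanish, yet that
    composite reaches the nonzero class of the generator. *)
Lemma top_lift (x y : O) (S S' : lmodType A)
    (q : {linear lideal (ids x) -> S}) (q' : {linear lideal (ids y) -> S'}) :
  surjective q -> surjective q' ->
  (forall u, q' u = 0 <-> lideal_rad (ids_prim y) u) ->
  mod_iso S S' -> exists t : {linear lideal (ids x) -> lideal (ids y)}, surjective t.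
Proof.
move=> q_surj q'_surj q'_ker [f f_bij].
have [t tE] := lideal_projective (idsM x) (f \o q) q'_surj.
have sIm : submodule (fun m => exists u, t u = m).
  split=> [|a _ _ [u <-] [v <-]]; first by exists 0; rewrite linear0.
  by exists (a *: u + v); rewrite linearP.
exists t; have [//|rad] := proper_sub_rad (ids_prim y) sIm.
case: (@gen_notin_rad _ (ids_prim y)); apply/q'_ker; set g := lideal_gen _.
have [s sE] := bij_surj f_bij (q' g).
have [u uE] := q_surj s.
suff : q' (t u) = 0 by rewrite tE /= uE sE.
by apply/q'_ker/rad; exists u.
Qed.

Lemma num_simple_modules : num_iso_classes (@simple_module A) #|O|.
Proof.
have top_ex x : exists S : lmodType A, exists q : {linear lideal (ids x) -> S},
    surjective q /\ forall u, q u = 0 <-> lideal_rad (ids_prim x) u.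
  exact: submodule_quotient (lideal_rad_submodule (ids_prim x)).
have [S SP] := choice top_ex.
exists (S \o enum_val); split=> [i|i j Sij|M M_simple] /=.
- by have [q [q_surj q_ker]] := SP (enum_val i); apply: top_simple q_ker.
- have [q [q_surj q_ker]] := SP (enum_val i).
  have [q' [q'_surj q'_ker]] := SP (enum_val j).
  have [t t_surj] := top_lift q_surj q'_surj q'_ker Sij.
  have [t' t'_surj] := top_lift q'_surj q_surj q_ker (mod_iso_sym Sij).
  have [d Ai_span] := lideal_kspanned (idsM (enum_val i)).
  (* Surjections both ways between finite-dimensional modules are isomorphisms, which contradicts
     basicness for distinct indices. *)
  have t't_surj : surjective (t' \o t).
    by move=> u; have [v <-] := t'_surj u; have [w <-] := t_surj v; exists w.
  have t't_bij := surjective_bij (@in_alg_central k A) Ai_span t't_surj.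
  apply/enum_val_inj/eqP; apply: contrapT => /negP /ids_basic; apply.
  exists t; apply: inj_surj_bij => // u v tuv; apply: (bij_inj t't_bij).
  by rewrite /= tuv.
have [M0 _] := M_simple.
have [m /eqP m_neq0] : exists m : M, m <> 0 by apply/existsNP.
have [x xm] : exists x, ids x *: m <> 0.
  apply: contrapT => /forallNP all0; case/eqP: m_neq0.
  rewrite -[m]scale1r; case: ids_complete => _ _ <-.
  by rewrite scaler_suml big1 // => x _; apply: contrapT => /all0.
have [q [q_surj q_ker]] := SP x; have [f fE] := lideal_map (ids x) m.
exists (enum_rank x); rewrite /= enum_rankK.
apply: (simple_cover q_surj q_ker M_simple (f := f)).
by exists (lideal_gen (idsM x)); rewrite fE.
Qed.

End Simples.

(** * The tilting module *)

(** An element annihilating the module annihilates its free summand, in particular a basis vector of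
    it. *)
Lemma free_summand_faithful (R : pzRingType) (E F : idem_elt R) (b : R) :
  has_nonzero_free_summand (peirce E F) ->
  idem_val E * b * idem_val E = b ->
  (forall m : peirce E F, b * peirce_val m = 0) -> b = 0.
Proof.
move=> [[|n] [n_gt0 /direct_summand_retract[i [r iK]]]] bE b0 //.
have bP : b \in peirce_pred E E by rewrite inE bE.
pose b' : corner E := Peirce bP.
have b'i v : b' *: i v = 0 by apply/val_inj/b0.
have := b'i (delta_mx 0 0); rewrite -linearZ /= -[0 in RHS](linear0 i).
move=> /(can_inj iK)/matrixP/(_ 0 0); rewrite !mxE mulr1.
exact: (congr1 (@peirce_val R E E)).
Qed.

(** * Existence of the minimal presentation and of the transpose *)

Section Presentation.
Variables (k : fieldType) (A : falgType k) (e : A).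
Hypothesis ee : e * e = e.

Let cee : (e : A^c) * e = e. Proof. exact: ee. Qed.
Local Notation eA := (@lideal A^c e).
Local Notation val0 y := (lideal_val y : A).
Variables (N : lmodType A^c) (p : {linear eA -> N}).
Hypothesis p_surj : surjective p.
Hypothesis p_ker : forall y, p y = 0 <-> val0 y * e = 0.

(** If the generator is u + v with u in U and p v = 0, multiplying on the right by e kills v and
    fixes the generator, which is thus ue and lies in U. *)
Lemma presentation_cover : proj_cover_of_image p.
Proof.
split=> [||U [U0 Ulin] UK x].
- exact: lideal_fin_gen.
- exact: lideal_projective.
have [u [v [Uu /p_ker ve genE]]] := UK (lideal_gen cee).
suff Ugen : U (lideal_gen cee).
  by rewrite [x](lidealE cee) -[_ *: _]addr0; apply: Ulin.
suff -> : lideal_gen cee = (e : A^c) *: u + 0 by apply: Ulin.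
rewrite addr0; apply/val_inj => /=.
have uvE : e * e = (val0 u + val0 v) * e.
  exact: (congr1 (fun y : eA => val0 y * e) genE).
by rewrite -[LHS]ee uvE mulrDl ve addr0.
Qed.

Lemma minimal_presentation_exists :
  exists (P1 : lmodType A^c) (u : {linear P1 -> eA}), min_proj_presentation u p.
Proof.
have sK : submodule (fun y => p y = 0).
  by split=> [|a u v pu pv]; rewrite ?linear0 // linearP pu pv scaler0 addr0.
have [L [j [j_inj jP]]] := submodule_incl sK.
have L_fg : fin_gen L.
  have [d [b bP]] := falg_kspanned A.
  (* The kernel is eA(1-e), spanned by the elements e b_i (1-e) for a spanning family b of A. *)
  have yL i : exists l, val0 (j l) = e * (b i : A) * (1 - e).
    have yP : (e * (b i : A) * (1 - e) : (A^c)^o) \in lideal_pred (e : A^c).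
      by apply/eqP; rewrite -[LHS]/(e * (e * _ * _) : A) !mulrA ee.
    have /jP[l lE] : p (Lideal yP) = 0.
      by apply/p_ker; rewrite /= -mulrA mulrBl mul1r ee subrr mulr0.
    by exists l; rewrite lE.
  have [s sE] := choice yL; exists d, s => l.
  have [c cE] := bP (val0 (j l)); exists (fun i => in_algc A (c i)).
  apply: j_inj; apply/val_inj; rewrite linear_sum raddf_sum /=.
  have le : val0 (j l) * e = 0 by apply/p_ker/jP; exists l.
  have el : e * val0 (j l) = val0 (j l) by apply: (lideal_mulr (j l)).
  have -> : lideal_val (j l) = e * val0 (j l) * (1 - e) :> A.
    by rewrite el mulrBr le mulr1 subr0.
  rewrite cE mulr_sumr mulr_suml; apply: eq_bigr => i _.
  rewrite linearZ -[RHS]/(val0 (j (s i)) * ((c i)%:A : A)) sE mulr_algr.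
  by rewrite -[_ *: b i]/((c i)%:A * (b i : A)) mulr_algl -scalerAr -scalerAl.
have [P1 [r [r_surj [P1_fg P1_proj superfl]]]] :=
  proj_cover_exists_fin_gen (phi := in_algc A) (@in_algc_central k A)
    (falgc_kspanned A) L_fg.
exists P1, (j \o r); split=> //; first 1 last.
- exact: presentation_cover.
- split=> // U sU UK; apply: superfl => // x.
  have [u [v [Uu jrv ->]]] := UK x; exists u, v; split=> //.
  by apply: j_inj; rewrite linear0.
move=> y; split=> [/jP[l <-]|[x <-]]; last by apply/jP; exists (r x).
by have [x <-] := r_surj l; exists x.
Qed.

Lemma transpose_exists : exists C, is_transpose N C.
Proof.
have [P1 [u u_min]] := minimal_presentation_exists.
have sI : submodule (fun h => exists g, star_map u g = h).
  split=> [|a _ _ [x <-] [y <-]]; first by exists 0; rewrite linear0.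
  by exists (a *: x + y); rewrite linearP.
have [C [q [q_surj qP]]] := submodule_quotient sI.
by exists C, P1, eA, u, p; split=> //; exists q.
Qed.

End Presentation.

(** * Counting the indecomposable summands *)

Section CountSummands.
Variables (k : fieldType) (A : falgType k) (O : finType) (ids : O -> A) (z : O).
Hypothesis ids_complete : complete_primitive_orthogonal ids.
Hypothesis ids_basic : basic_for ids.
Variable C : lmodType A.
Hypothesis C_ind : indecomposable C.
Hypothesis C_nproj : ~ projective C.

Let T : lmodType A := (lideal (1 - ids z) * C)%type.
Hypothesis T_fg : fin_gen T.
(** C takes the place of A1_z, so the summands are indexed by the same set as the simple modules. *)
Let Y (x : O) : lmodType A := if x == z then C else lideal (ids x).

Let ids_prim x : primitive (ids x). Proof. by case: ids_complete. Qed.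
Let idsM x : ids x * ids x = ids x. Proof. by case: (ids_prim x). Qed.

Let Y_ind x : indecomposable (Y x).
Proof.
by rewrite /Y; case: eqP => // _; apply: lideal_indecomposable.
Qed.

Let eps_gen x : x != z ->
  exists m : lideal (1 - ids z), lideal_val m = ids x :> A.
Proof.
case: ids_complete => _ orth _ xz.
have mP : (ids x : A^o) \in lideal_pred (1 - ids z).
  by rewrite inE mulrBr mulr1 orth // subr0.
by exists (Lideal mP).
Qed.

(** These are the projections of T onto its summands: right multiplication by 1_x on A(1-e) for x <>
    z, and the projection onto C for z. They add up to the identity because the 1_x with x <> z sum
    to 1-e. *)
Let component x : exists c : {linear T -> T},
  [/\ exists (j : {linear Y x -> T}) (p : {linear T -> Y x}),
        cancel j p /\ forall t, c t = j (p t),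
      forall t, lideal_val (c t).1 =
        (if x == z then 0 else (lideal_val t.1 : A) * ids x) :> A
    & forall t, (c t).2 = if x == z then t.2 else 0].
Proof.
rewrite /Y; have [_|xz] := eqVneq x z.
  have j_lin : linear (fun y : C => (0, y) : T).
    by move=> a u v; apply: injective_projections => //=; rewrite scaler0 addr0.
  have [j jE] := linear_exists j_lin.
  exists (j \o snd); split=> [|t|t]; rewrite /= ?jE //.
  by exists j, snd; split=> // y; rewrite /= jE.
have [m mE] := eps_gen xz.
have j_lin : linear (fun y : lideal (ids x) => ((lideal_val y : A) *: m, 0) : T).
  move=> a u v; apply: injective_projections => /=; last by rewrite scaler0 addr0.
  by rewrite scalerA -scalerDl.
have [j jE] := linear_exists j_lin.
have [p pE] := lideal_map (1 - ids z)
  ((lideal_val m : A) *: lideal_gen (idsM x)).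
have jpE (t : T) : lideal_val (j (p t.1)).1 = (lideal_val t.1 : A) * ids x :> A.
  rewrite jE pE /=.
  rewrite -[LHS]/((lideal_val t.1 : A) * ((lideal_val m : A) * ids x)
    * lideal_val m).
  by rewrite mE !idsM -mulrA idsM.
exists (j \o (p \o fst)); split=> [|t|t]; rewrite /= ?jpE ?jE //.
exists j, (p \o fst); split=> // y; apply/val_inj => /=.
rewrite jE pE /=.
rewrite -[LHS]/((lideal_val y : A) * lideal_val m
  * ((lideal_val m : A) * ids x)).
by rewrite mE -mulrA !idsM lideal_mulr.
Qed.

Lemma num_indecomposable_summands :
  num_iso_classes (fun X => indecomposable X /\ direct_summand X T) #|O|.
Proof.
have [_ orth sum_ids] := ids_complete.
exists (Y \o enum_val); split=> [i|i j Yij|M [M_ind M_sum]] /=.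
- have [c [[j [p [jK _]]] _ _]] := component (enum_val i).
  by split; [exact: Y_ind | exact: retract_direct_summand jK].
- apply/enum_val_inj; move: Yij; rewrite /= /Y.
  (* Non-projectivity separates C from the other summands; basicness separates those from each
     other. *)
  have nproj x : ~ mod_iso (lideal (ids x)) C.
    move=> /mod_iso_sym[f /linear_inv[g [fK _]]]; apply: C_nproj.
    exact: projective_retract fK (lideal_projective (idsM x)).
  case: eqP => [->|_]; case: eqP => [->|_] //.
  + by move=> /mod_iso_sym/nproj.
  + by move=> /nproj.
  move=> Yij; apply/eqP; apply: contrapT => /negP ij.
  exact: ids_basic ij Yij.
have [c cP] := choice component.
have [i [r iK]] := direct_summand_retract M_sum.
have r_surj : surjective r by move=> m; exists (i m).
have [d M_span] := kspanned_fin_gen (falg_kspanned A) (fin_gen_surj r_surj T_fg).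
have [||x MY] := krull_schmidt (@in_alg_central k A) M_span
  (c := c) (Y := Y) _ _ Y_ind M_ind M_sum; last 1 first.
- by exists (enum_rank x); rewrite enum_rankK.
- move=> t; apply: injective_projections.
    apply/val_inj; rewrite !raddf_sum /=.
    transitivity ((lideal_val t.1 : A) * (\sum_(x | x != z) ids x)).
      rewrite mulr_sumr [RHS]big_mkcond; apply: eq_bigr => x _.
      by have [_ -> _] := cP x; case: eqP.
    have -> : \sum_(x | x != z) ids x = 1 - ids z.
      by rewrite -sum_ids [X in _ = X - _](bigD1 z) //= [RHS]addrC addKr.
    exact: lideal_mulr.
  rewrite raddf_sum (bigD1 z) //= big1 => [|x /negPf xz].
    by have [_ _ ->] := cP z; rewrite eqxx addr0.
  by have [_ _ ->] := cP x; rewrite xz.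
by move=> x; have [[j [p [_ ?]]] _ _] := cP x; exists j, p.
Qed.

End CountSummands.

Theorem theorem4p3 (k : closedFieldType) (A : falgType k)
    (O : finType) (ids : O -> idem_elt A) (z : O)
    (ids_complete :
       complete_primitive_orthogonal (fun x : O => idem_val (ids x)))
    (A_basic : basic_for (fun x : O => idem_val (ids x)))
    (eps_A_e : forall a : A, (1 - idem_val (ids z)) * a * idem_val (ids z) = 0)
    (eAe_selfinj : self_injective (corner (ids z)))
    (free_summand : exists x : O,
       x != z /\ has_nonzero_free_summand (peirce (ids z) (ids x))) :
  (exists C : lmodType A, is_tau_inv (lideal (idem_val (ids z))) C) /\
  (forall C : lmodType A, is_tau_inv (lideal (idem_val (ids z))) C ->
     tilting (lideal (1 - idem_val (ids z)) * C)%type).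
Proof.
set e := idem_val (ids z); have ee : e * e = e by apply: idem_valM.
have [ids_prim orth _] := ids_complete; have e_prim : primitive e := ids_prim z.
have [p [p_surj p_ker]] := corner_presentation e_prim eps_A_e eAe_selfinj.
split=> [|C]; first exact: (transpose_exists ee p_surj p_ker).
move=> /(transpose_change_cover p_surj (presentation_cover ee p_ker)).
move=> [P1 [u [q [up_exact u_cover q_coker]]]].
(* For the given x the space eA1_x lies in eA(1-e), because 1_x e = 0, and its free summand already
   detects b. *)
have faithful b : b * e = b ->
    (forall y, e * y = y -> y * e = 0 -> b * y = 0) -> b = 0.
  move=> be b0; have [x [xz free_x]] := free_summand.
  apply: (free_summand_faithful free_x) => [|m].
    by rewrite -/e -mulrA be (eps_annihilates_mull eps_A_e be).
  apply: b0; first exact: peirce_idl.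
  by rewrite -(peirce_idr m) -mulrA orth ?mulr0.
have fg := transpose_tilting_fin_gen e_prim u_cover q_coker.
split=> //.
- exact: (transpose_tilting_pd e_prim faithful p_ker up_exact u_cover q_coker).
- exact: (transpose_tilting_Ext1 e_prim faithful p_ker up_exact u_cover q_coker).
exists #|O|; split; last exact: num_simple_modules ids_complete A_basic.
apply: (num_indecomposable_summands ids_complete A_basic) => //.
- exact: (transpose_indecomposable e_prim eps_A_e faithful p_ker
            up_exact u_cover q_coker).
exact: (transpose_not_projective e_prim eps_A_e faithful p_ker
          up_exact u_cover q_coker).
Qed.
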